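(* Let $(m,n)$ be an admissible couple of positive integers and let $\mathbf{Q}=\mathbf{Q}_{m,n}$ be the conformal $Q$-curvature increment operator on the standard sphere $(\mathbb{S}^n,g_0)$. Let $L=d\mathbf{Q}[0]: C^\infty(\mathbb{S}^n)\to C^\infty(\mathbb{S}^n)$ be the linearization of $\mathbf{Q}$ at $u=0$, and let $\Lambda_1$ be the $(n+1)$-dimensional space of first spherical harmonics on $(\mathbb{S}^n,g_0)$. Then $L$ is (formally) self-adjoint in $L^2(\mathbb{S}^n,d\mu_0)$, and $\operatorname{Ker} L=\Lambda_1$.
   Context: A couple of positive integers $(m,n)$ is called admissible if $n>1$, and $n\ge 2m$ in case $n$ is even. $(\mathbb{S}^n,g_0)$ is the standard round unit $n$-sphere, $d\mu_0$ is its Riemannian measure, functions are real-valued and smooth, and $\Delta_0$ is the positive Laplacian of $g_0$. For $u\in C^\infty(\mathbb{S}^n)$ set $g_u=e^{2u}g_0$. $\Lambda_1$ is the eigenspace of $\Delta_0$ for the eigenvalue $n$, i.e. the restrictions to $\mathbb{S}^n$ of linear forms on $\mathbb{R}^{n+1}$. The linearization is $L v=\frac{d}{dt}\mathbf{Q}[tv]\big|_{t=0}$. Define the Paneitz--Branson operator of $g_0$ by $$P_0=\prod_{k=1}^m\left[\Delta_0+\left(\tfrac n2-k\right)\left(\tfrac n2+k-1\right)\right].$$ Case $n=2m$: $Q_0=Q(g_0)=(2m-1)!$, $\;Q(g_u)=e^{-2mu}(Q_0+P_0[u])$, and the $Q$-curvature increment operator is $\mathbf{Q}[u]=Q(g_u)-Q_0$.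 Case $n\ne 2m$: $P_u(\cdot)=e^{-(\frac n2+m)u}P_0\left[e^{(\frac n2-m)u}\,\cdot\,\right]$, the $Q$-curvature $Q(g_u)$ is defined by $\left(\frac n2-m\right)Q(g_u)=P_u(1)$, $Q_0=Q(g_0)$, and the (renormalized) $Q$-curvature increment operator is $\mathbf{Q}[u]=\left(\frac n2-m\right)\left[Q(g_u)-Q_0\right]$. *)

(* Defs.v *)
From HB Require Import structures.
From mathcomp Require Import all_boot all_order all_algebra.
From mathcomp Require Import all_classical all_reals all_analysis.
From mathcomp Require Import measurable_realfun.

Set Implicit Arguments.
Unset Strict Implicit.
Unset Printing Implicit Defensive.

Import Order.TTheory GRing.Theory Num.Theory.
Import numFieldNormedType.Exports.

Local Open Scope classical_set_scope.
Local Open Scope ring_scope.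

(* Lebesgue measure on R^d, as an iterated product measure on [d.-tuple R]. *)
Section lebesgue_tuple.
Variable R : realType.
Local Notation mR := (measurableTypeR R).

Definition tcons d (p : mR * d.-tuple mR) : d.+1.-tuple mR :=
  [tuple of p.1 :: p.2].

Lemma measurable_tcons d : measurable_fun [set: mR * d.-tuple mR] (@tcons d).
Proof. exact: measurable_cons. Qed.

Section step.
Variables (d : nat) (mu : {sigma_finite_measure set (d.-tuple mR) -> \bar R}).

Definition lebesgue_step : set (d.+1.-tuple mR) -> \bar R :=
  pushforward (lebesgue_measure \x mu)%E (@tcons d).

Let step0 : lebesgue_step set0 = 0%E.
Proof. by rewrite /lebesgue_step /pushforward preimage_set0 measure0. Qed.

Let step_ge0 A : (0 <= lebesgue_step A)%E.
Proof. by rewrite /lebesgue_step /pushforward. Qed.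

Let step_sigma_additive : semi_sigma_additive lebesgue_step.
Proof.
move=> F mF tF mUF; rewrite /lebesgue_step /pushforward preimage_bigcup.
have mtF i : measurable (@tcons d @^-1` F i).
  by rewrite -[X in measurable X]setTI; exact: measurable_tcons.
apply: measure_semi_sigma_additive => //; last exact: bigcup_measurable.
apply/trivIsetP => i j _ _ ij; rewrite -preimage_setI.
by move/trivIsetP : tF => /(_ i j Logic.I Logic.I ij) ->; rewrite preimage_set0.
Qed.

HB.instance Definition _ := isMeasure.Build _ _ _ lebesgue_step
  step0 step_ge0 step_sigma_additive.

Let step_sigma_finite : sigma_finite setT lebesgue_step.
Proof.
have /sigma_finiteP[F [TF ndF Foo]] := sigma_finiteT (@lebesgue_measure R).
have /sigma_finiteP[G [TG ndG Goo]] := sigma_finiteT mu.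
pose u (t : d.+1.-tuple mR) : mR * d.-tuple mR :=
  (thead t, [tuple of behead t]).
have mu_ : measurable_fun setT u.
  apply: measurable_fun_pair; first exact: measurable_tnth.
  exact: measurable_behead.
have uK A : @tcons d @^-1` (u @^-1` A) = A.
  by apply/seteqP; split=> -[x t] /=; rewrite /u theadE;
     (have -> : [tuple of behead (tcons (x, t))] = t by exact/val_inj).
exists (fun i => u @^-1` (F i `*` G i)) => [|i].
  rewrite -preimage_bigcup; apply/seteqP; split=> // t _ /=.
  have [i _ Fi] : (\bigcup_i F i) (thead t) by rewrite -TF.
  have [j _ Gj] : (\bigcup_i G i) [tuple of behead t] by rewrite -TG.
  exists (maxn i j) => //; split => /=.
  - by move: Fi; exact/subsetPset/ndF/leq_maxl.
  - by move: Gj; exact/subsetPset/ndG/leq_maxr.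
have [mF Fi] := Foo i; have [mG Gi] := Goo i.
have mFG := measurableX mF mG; split.
  by rewrite -[X in measurable X]setTI; exact: mu_.
rewrite /lebesgue_step /pushforward uK product_measure1E//.
by rewrite lte_mul_pinfty// ge0_fin_numE.
Qed.

HB.instance Definition _ := Measure_isSigmaFinite.Build _ _ _ lebesgue_step
  step_sigma_finite.

End step.

Fixpoint lebesgue_tuple (d : nat) :
    {sigma_finite_measure set (d.-tuple mR) -> \bar R} :=
  match d with
  | 0 => \d_[tuple]
  | d'.+1 => lebesgue_step (lebesgue_tuple d')
  end.

End lebesgue_tuple.

(* [`|x|] is the sup norm of 'rV[R]_d; this is the Euclidean one. *)
Definition enorm (R : realType) d (x : 'rV[R]_d) : R :=
  Num.sqrt (\sum_i x ord0 i ^+ 2).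

(* The unit sphere S^n of R^(n+1). *)
Definition sphere (R : realType) (n : nat) : Type :=
  {x : 'rV[R]_n.+1 | enorm x == 1}.

Section sphere.
Variables (R : realType) (n : nat).
Local Notation mR := (measurableTypeR R).
Local Notation E := 'rV[R]_n.+1.
Local Notation S := (sphere R n).

HB.instance Definition _ := SubType.on S.
HB.instance Definition _ := Choice.on S.

Let pole_subproof : enorm (delta_mx 0 0 : E) == 1.
Proof.
rewrite /enorm (bigD1 ord0)//= mxE !eqxx expr1n big1 ?addr0 ?sqrtr1// => i i0.
by rewrite mxE (negbTE i0) andbF expr0n.
Qed.

Definition pole : S := exist _ (delta_mx 0 0 : E) pole_subproof.

HB.instance Definition _ := isPointed.Build S pole.

(* The radial projection x |-> x / |x|, with an arbitrary value at 0. *)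
Definition radial (x : E) : S := insubd pole ((enorm x)^-1 *: x).

Definition sphere_coord (x : S) : n.+1.-tuple mR := [tuple val x ord0 i | i < n.+1].

(* The Borel sigma-algebra of S^n. *)
HB.instance Definition _ :=
  Measurable.copy S (g_sigma_algebra_preimageType sphere_coord).

Definition row_of_tuple (t : n.+1.-tuple mR) : E := \row_i tnth t i.

Definition punctured_ball : set (n.+1.-tuple mR) :=
  [set t | 0 < enorm (row_of_tuple t) <= 1].

(* The Riemannian measure of the round metric, as the cone measure:
   mu0 A = (n + 1) * vol {r x | 0 < r <= 1, x in A}. *)
Definition mu0 (A : set S) : \bar R :=
  (n.+1%:R%:E * lebesgue_tuple R n.+1
     ((radial \o row_of_tuple) @^-1` A `&` punctured_ball))%E.

Lemma measurable_enorm :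
  measurable_fun setT (fun t => enorm (row_of_tuple t) : mR).
Proof.
apply: (@measurableT_comp _ _ _ _ _ _ (@Num.sqrt R : mR -> mR)).
  by apply: nondecreasing_measurable => // x y; exact: ler_wsqrtr.
apply: measurable_sum => i; apply: measurable_funX.
by under eq_fun do rewrite mxE; exact: measurable_tnth.
Qed.

Lemma measurable_punctured_ball : measurable punctured_ball.
Proof.
have -> : punctured_ball = (fun t => enorm (row_of_tuple t)) @^-1` `]0, 1].
  by apply/seteqP; split => t; rewrite /punctured_ball /= in_itv.
by rewrite -[X in measurable X]setTI; exact: measurable_enorm.
Qed.

Lemma measurable_radial : measurable_fun setT (radial \o row_of_tuple).
Proof.
suff mcoord : measurable_fun setT (sphere_coord \o (radial \o row_of_tuple)).
  move=> _ _ [B mB <-]; rewrite !setTI -comp_preimage.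
  by rewrite -[X in measurable X]setTI; exact: mcoord.
apply/measurable_fun_tnthP => i.
pose e t := enorm (row_of_tuple t).
have me : measurable_fun setT (fun t => (e t)^-1 : mR).
  rewrite (_ : (fun t => _) = (fun t => powR (e t) (-1))).
    apply: (@measurableT_comp _ _ _ _ _ _ (fun x : mR => powR x (-1))).
      exact: measurable_powR.
    exact: measurable_enorm.
  by apply/funext => t; rewrite powR_inv1// sqrtr_ge0.
rewrite (_ : _ \o _ = fun t => if `|(e t)^-1| * e t == 1
    then (e t)^-1 * tnth t i else val pole ord0 i); last first.
  apply/funext => t; rewrite /= tnth_mktuple /radial val_insubd.
  have -> : enorm ((enorm (row_of_tuple t))^-1 *: row_of_tuple t) =
      `|(e t)^-1| * e t.
    rewrite {1}/enorm; under eq_bigr do rewrite mxE exprMn.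
    by rewrite -mulr_sumr sqrtrM ?sqr_ge0// sqrtr_sqr.
  by case: ifP => //; rewrite !mxE.
apply: measurable_fun_ifT => //.
  apply: measurable_fun_eqr => //; apply: measurable_funM => //.
    by apply: measurableT_comp.
  exact: measurable_enorm.
by apply: measurable_funM => //; exact: measurable_tnth.
Qed.

Let mu0_0 : mu0 set0 = 0%E.
Proof. by rewrite /mu0 preimage_set0 set0I measure0 mule0. Qed.

Let mu0_ge0 A : (0 <= mu0 A)%E.
Proof. by rewrite /mu0 mule_ge0// lee_fin. Qed.

Let mu0_sigma_additive : semi_sigma_additive mu0.
Proof.
move=> F mF tF mUF.
have mF' i : measurable ((radial \o row_of_tuple) @^-1` F i).
  by rewrite -[X in measurable X]setTI; exact: measurable_radial.
have tF' : trivIset setT (fun i => (radial \o row_of_tuple) @^-1` F i).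
  apply/trivIsetP => i j _ _ ij; rewrite -preimage_setI.
  by move/trivIsetP : tF => /(_ i j Logic.I Logic.I ij) ->; rewrite preimage_set0.
rewrite /mu0 preimage_bigcup.
have := @measure_semi_sigma_additive _ _ _ (mscale (n.+1%:R%:nng : {nonneg R})
  (mrestr (lebesgue_tuple R n.+1) measurable_punctured_ball)) _ mF' tF'.
by apply; exact: bigcup_measurable.
Qed.

HB.instance Definition _ := isMeasure.Build _ _ _ mu0
  mu0_0 mu0_ge0 mu0_sigma_additive.

End sphere.

Section calculus.
Variables (R : realType) (d : nat).

Definition partial (i : 'I_d) (F : 'rV[R]_d -> R) : 'rV[R]_d -> R :=
  fun x => 'D_(delta_mx ord0 i) F x.

(* C^oo on U (meant for open U): the iterated partial derivatives of all orders
   exist and are continuous at every point of U. *)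
Definition smooth_on (U : set 'rV[R]_d) (F : 'rV[R]_d -> R) : Prop :=
  forall (s : seq 'I_d) (x : 'rV[R]_d), U x ->
    {for x, continuous (foldr partial F s)} /\
    forall i, derivable (foldr partial F s) x (delta_mx ord0 i).

End calculus.

Section round_sphere.
Variables (R : realType) (n : nat).
Local Notation E := 'rV[R]_n.+1.
Local Notation S := (sphere R n).
Implicit Types (f u v : S -> R) (x : S).

(* The extension of f to R^(n+1) \ {0} that is constant along rays. *)
Definition ray_ext f : E -> R := f \o @radial R n.

(* f is in C^oo(S^n): since [radial] is a smooth retraction of R^(n+1) \ {0}
   onto S^n, this amounts to the smoothness of [ray_ext f]. *)
Definition smooth f : Prop := smooth_on [set z : E | z != 0] (ray_ext f).

(* The gradient for the round metric, as a tangent vector field in R^(n+1): the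
   Euclidean gradient of [ray_ext f] has no radial component. *)
Definition grad0 f x : E := \row_i partial i (ray_ext f) (val x).

(* The divergence, for the round metric, of a tangent field X, i.e. the trace of
   the tangential derivative of X: the extension of X is constant along rays, so
   the radial direction does not contribute to the sum. *)
Definition div0 (X : S -> E) x : R :=
  \sum_i partial i (ray_ext (fun y => X y ord0 i)) (val x).

(* The Laplacian of the round metric, with nonnegative spectrum. *)
Definition lap0 f x : R := - div0 (grad0 f) x.

Definition P0_factor (k : nat) f x : R :=
  lap0 f x + (n%:R / 2 - k%:R) * (n%:R / 2 + k%:R - 1) * f x.

(* The Paneitz--Branson operator of g_0; the factors commute on C^oo(S^n). *)
Definition P0 (m : nat) : (S -> R) -> (S -> R) :=
  \big[comp/id]_(1 <= k < m.+1) P0_factor k.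

(* The operator P_u of the conformal metric e^(2u) g_0, for n <> 2m. *)
Definition Pconf (m : nat) u f x : R :=
  expR (- (n%:R / 2 + m%:R) * u x) *
  P0 m (fun y => expR ((n%:R / 2 - m%:R) * u y) * f y) x.

(* The Q-curvature Q(g_u) of g_u = e^(2u) g_0. *)
Definition Qcurv (m : nat) u x : R :=
  if n == (2 * m)%N then
    expR (- (2 * m)%:R * u x) * (((2 * m).-1)`!%:R + P0 m u x)
  else (n%:R / 2 - m%:R)^-1 * Pconf m u (cst 1) x.

Definition Q0 (m : nat) x : R := Qcurv m (cst 0) x.

(* The (for n <> 2m, renormalized) Q-curvature increment operator. *)
Definition Qincr (m : nat) u x : R :=
  if n == (2 * m)%N then Qcurv m u x - Q0 m x
  else (n%:R / 2 - m%:R) * (Qcurv m u x - Q0 m x).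

Definition linQ (m : nat) v x : R :=
  derive1 (fun t : R => Qincr m (fun y => t * v y) x) 0.

(* The first spherical harmonics: the eigenspace of [lap0] for the eigenvalue n. *)
Definition Lambda1 : set (S -> R) :=
  [set v | smooth v /\ forall x, lap0 v x = n%:R * v x].

(* L, as an operator on C^oo(S^n), is symmetric for the L^2(mu0) inner product. *)
Definition formally_self_adjoint (L : (S -> R) -> (S -> R)) : Prop :=
  forall v w : S -> R, smooth v -> smooth w ->
    \int[@mu0 R n]_x (L v x * w x) = \int[@mu0 R n]_x (v x * L w x).

Definition Ker (L : (S -> R) -> (S -> R)) : set (S -> R) :=
  [set v | smooth v /\ forall x, L v x = 0].

End round_sphere.

Definition admissible (m n : nat) : Prop :=
  [/\ (0 < m)%N, (1 < n)%N & ~~ odd n -> (2 * m <= n)%N].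

(* Main.v *)
Require Import Defs.
From HB Require Import structures.
From mathcomp Require Import all_boot all_order all_algebra.
From mathcomp Require Import all_classical all_reals all_analysis.
From mathcomp Require Import measurable_realfun.
From mathcomp Require Import ring lra zify.
From mathcomp Require complex.

(** Let [h = n / 2], let Δ be the Laplacian of the round sphere and let [g] be the
    polynomial such that [P0 = g(Δ)].

    The linearization. Since a factor of [P0] maps [exp (t w)] times a polynomial in
    [t] with smooth coefficients to a function of the same form ([hfam_P0r]),
    [P0 (exp (t w))] is differentiable in [t]. The linearization at [0] of the
    increment operator is then [q(Δ)] ([is_derive_Qincr]), where [q = g - (2m)!] if
    [n = 2m] and [q = (h - m) g - (h + m) g(0)] otherwise. Its formal
    self-adjointness follows from that of Δ, i.e. from Green's identity ([green]).

    Green's identity. The measure of the sphere is the cone measure, and the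
    functions [f] and [g] extend to functions [F] and [G] constant along rays. The
    identity amounts to the vanishing of the integral of the divergence of
    [psi (|z|^2) G grad F], where [psi] has compact support in the positive reals:
    each partial derivative integrates to zero along lines by the fundamental
    theorem of calculus, hence over the space by Fubini. As [grad F] is orthogonal to
    [z], the derivative of [psi] does not appear, and by homogeneity the divergence is
    [psi (|z|^2) / |z|^2] times a function constant along rays. It remains to let
    [psi (s) / s] tend to the indicator function of the interval (0, 1].

    The spectrum. Only the location of the eigenvalues is needed, not a
    decomposition into spherical harmonics ([eigenvalue_sphere]). An eigenvalue
    that is nonnegative has the form [b (b + n - 1)] with [b >= 0], and the
    eigenfunction extends to a harmonic function homogeneous of degree [b], whose
    partial derivatives are harmonic and homogeneous of degree [b - 1]. If [b] is
    not an integer, repeating this leads to degrees between [-1] and [0], where the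
    eigenvalue is negative since [n > 1]; by Green's identity these eigenfunctions
    vanish, and by Euler's identity so does the initial one. Thus every eigenvalue is
    one of the [l_j = j (j + n - 1)].

    The kernel. If [q(Δ) f = 0], factor [q] over the reals ([polylap_kernel]): the
    factors [(X - a)^2 + b^2] with [b <> 0] give injective operators, [X - a] gives
    an injective operator unless [a] is one of the [l_j], and by self-adjointness a
    power of [Δ - a] has the same kernel as [Δ - a]. So it is enough that [l_1 = n]
    is the only [l_j] at which [q] vanishes ([qpoly_root]). With [u = j + h],
    [g(l_j)] is the product of the [(u - k) (u + k - 1)] for [1 <= k <= m], that
    is [Gamma (u + m) / Gamma (u - m)], so that
    [g(l_(j+1)) / g(l_j) = (u + m) / (u - m)]. Admissibility means that [u] is never
    one of [1, ..., m], except for [j = 0] when [n = 2m], where [g(0) = 0].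
    Therefore [|g(l_j)|] increases strictly with [j], while in both cases [q(l_j)] is
    a nonzero multiple of [g(l_j) - g(l_1)]. *)

Set Implicit Arguments.
Unset Strict Implicit.
Unset Printing Implicit Defensive.

Import Order.TTheory GRing.Theory Num.Theory.
Import numFieldNormedType.Exports.

Local Open Scope classical_set_scope.
Local Open Scope ring_scope.

(** * Directional and partial derivatives *)

Section growth_rate.
Variables (R : realType) (V : normedModType R).
Implicit Types (F : V -> R) (x v : V).

Lemma is_deriveE F x v l : is_derive x v F l <->
  h^-1 * (F (h *: v + x) - F x) @[h --> (0:R)^'] --> l.
Proof.
split=> [[dF <-]|cF]; first exact: dF.
have dF : derivable F x v by apply/cvg_ex; exists l.
by apply: DeriveDef => //; apply: cvg_lim.
Qed.

End growth_rate.

Section directional.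
Variables (R : realType) (V : normedModType R).
Implicit Types (F : V -> R) (x v : V).

Lemma is_derive_line F x v l :
  is_derive x v F l <-> is_derive (0 : R) (1 : R) (fun h : R => F (h *: v + x)) l.
Proof.
have e : (fun h : R => h^-1 * (F ((h *: (1 : R^o) + 0) *: v + x) - F (0 *: v + x))) =
         (fun h : R => h^-1 * (F (h *: v + x) - F x)).
  by apply/funext => h; rewrite scale0r add0r addr0 [_%:A]mulr1.
by split=> /is_deriveE cF; apply/is_deriveE; move: cF; rewrite e.
Qed.

Lemma is_derive_line_at F x v (s l : R) : is_derive (s *: v + x) v F l ->
  is_derive s (1 : R) (fun h : R => F (h *: v + x)) l.
Proof.
move=> /is_deriveE cF; apply/is_deriveE; apply: cvg_trans cF.
apply: near_eq_cvg; near=> h.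
by rewrite /= [_%:A]mulr1 scalerDl addrA.
Unshelve. all: by end_near. Qed.

Lemma is_derive_scale_dir F x v (a l : R) :
  is_derive x v F l -> is_derive x (a *: v) F (a * l).
Proof.
move=> /is_derive_line dF; apply/is_derive_line.
have -> : (fun h : R => F (h *: (a *: v) + x)) =
  (fun h : R => F (h *: v + x)) \o (fun h => h * a).
  by apply/funext => h /=; rewrite scalerA.
have d0 : is_derive (0 * a : R) (1 : R) (fun h : R => F (h *: v + x)) l by rewrite mul0r.
have d1 : is_derive (0 : R) (1 : R) (fun h : R => h * a) a.
  apply: (@is_derive_eq _ _ _ (fun h : R => h * a) 0 1 a (0 *: 0 + a *: 1)); last first.
    by rewrite scaler0 add0r /GRing.scale /= mulr1.
  exact: (@is_deriveM _ _ id (cst a)).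
by rewrite mulrC; exact: (@is_derive1_comp _ (fun h : R => F (h *: v + x)) (fun h => h * a) 0 _ _ d0 d1).
Qed.

Lemma derivable_scale_dir F x v (a : R) :
  derivable F x v -> derivable F x (a *: v).
Proof. by move=> dF; case: (is_derive_scale_dir a (derivableP dF)). Qed.

Lemma derive_scale_dir F x v (a : R) :
  derivable F x v -> 'D_(a *: v) F x = a * 'D_v F x.
Proof. by move=> dF; case: (is_derive_scale_dir a (derivableP dF)). Qed.

Lemma mean_value_line F x v :
  (forall s : R, 0 <= s <= 1 -> derivable F (s *: v + x) v) ->
  exists2 s : R, 0 < s < 1 & F (v + x) - F x = 'D_v F (s *: v + x).
Proof.
move=> dF; pose g (s : R) := F (s *: v + x).
have dg (s : R) : 0 <= s <= 1 -> is_derive s (1:R) g ('D_v F (s *: v + x)).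
  by move=> s01; apply: is_derive_line_at; apply/derivableP/dF.
have [||s s01] := @MVT R g (fun s => 'D_v F (s *: v + x)) 0 1 ltr01.
- by move=> s; rewrite in_itv/= => /andP[s0 s1]; apply: dg; rewrite !ltW.
- apply: derivable_within_continuous => s; rewrite in_itv/= => s01.
  by have [] := dg s s01.
rewrite /g scale1r scale0r add0r subr0 mulr1 => e.
by exists s => //; move: s01; rewrite in_itv.
Qed.

Lemma is_derive_compr (phi : R -> R) F x v (a b : R) :
  is_derive (F x) (1 : R) phi a -> is_derive x v F b ->
  is_derive x v (phi \o F) (a * b).
Proof.
move=> dphi /is_derive_line dF; apply/is_derive_line.
rewrite -[F x]add0r -{1}(add0r x) in dphi.
have d0 : is_derive (F (0 *: v + x)) (1 : R) phi a.
  by move: dphi; rewrite add0r scale0r.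
exact: (@is_derive1_comp _ phi (fun h : R => F (h *: v + x)) 0 a b d0 dF).
Qed.

End directional.

Section partials.
Variables (R : realType) (d : nat).
Local Notation E := 'rV[R]_d.
Implicit Types (F G : E -> R) (x y : E) (U : set E) (i j : 'I_d).
Local Notation e_ i := (delta_mx ord0 i : E).

Lemma norm_delta i : `|e_ i| <= 1.
Proof.
rewrite /Num.Def.normr /= mx_normrE; apply: bigmax_le => // -[a b] _ /=.
by rewrite mxE; case: (_ && _); rewrite ?normr1 ?normr0.
Qed.

Lemma near_ball_open U x : open U -> U x ->
  exists2 r : R, 0 < r & forall y, `|y - x| < r -> U y.
Proof.
move=> oU Ux; have /nbhs_ballP[r r0 rU] := open_nbhs_nbhs (conj oU Ux).
exists r => // y yx; apply: rU.
by rewrite -ball_normE /ball_ /= distrC.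
Qed.

Lemma continuous_ball F x (e : R) : {for x, continuous F} -> 0 < e ->
  exists2 r : R, 0 < r & forall y, `|y - x| < r -> `|F y - F x| < e.
Proof.
move=> cF e0; have /cvgrPdist_lt/(_ e e0)/nbhs_ballP[r r0 rF] := cF.
exists r => // y yx; rewrite distrC; apply: rF.
by rewrite -ball_normE /ball_ /= distrC.
Qed.

(** The increment in the added direction [e_ i] is a value of the continuous
    function [partial i F] near [x], by the mean value theorem. *)
Lemma is_derive_add_dir U F x w (c l : R) i : open U -> U x ->
  (forall y, U y -> derivable F y (e_ i)) -> {for x, continuous (partial i F)} ->
  is_derive x w F l -> is_derive x (w + c *: e_ i) F (l + c * partial i F x).
Proof.
move=> oU Ux dF cF /is_deriveE dw; apply/is_deriveE.
pose r (h : R) := h^-1 * (F (h *: (c *: e_ i) + (h *: w + x)) - F (h *: w + x)).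
suff rc : r h @[h --> (0:R)^'] --> c * partial i F x.
  apply: cvg_trans (cvgD dw rc); apply: near_eq_cvg.
  near=> h; rewrite /r /= !fctE -mulrDr; congr (_ * _).
  have -> : h *: (w + c *: e_ i) + x = h *: (c *: e_ i) + (h *: w + x).
    by rewrite scalerDr addrA [h *: w + _]addrC.
  by ring.
apply/cvgrPdist_lt => e e0.
pose C := 1 + `|c| + `|w|.
have C0 : 0 < C by rewrite /C ltr_wpDr// ltr_wpDr.
have e1 : 0 < e / C by rewrite divr_gt0.
have [r1 r10 Hr1] := near_ball_open oU Ux.
have [r2 r20 Hr2] := continuous_ball cF e1.
have small (h s : R) : `|h| < Num.min r1 r2 / C -> 0 <= s <= 1 ->
    `|s *: (h *: (c *: e_ i)) + (h *: w + x) - x| < Num.min r1 r2.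
  move=> hr /andP[s0 s1].
  rewrite addrA addrK scalerA mulrC -scalerA -scalerDr normrZ.
  rewrite ltr_pdivlMr// in hr; apply: le_lt_trans hr.
  rewrite ler_wpM2l// (le_trans (ler_normD _ _))// /C lerD2r.
  rewrite !normrZ (ger0_norm s0) -[leRHS]mul1r ler_pM// ?mulr_ge0//.
  apply: (@le_trans _ _ (`|c| * 1)); first by rewrite ler_wpM2l// norm_delta.
  by rewrite mulr1 lerDr.
near=> h.
have h0 : h != 0 by near: h; exact: nbhs_dnbhs_neq.
have hs : `|h| < Num.min r1 r2 / C.
  near: h; apply: dnbhs0_lt.
  by rewrite divr_gt0// lt_min r10.
rewrite /r.
have [s0 s1|s s01 ->] := @mean_value_line R _ F (h *: w + x) (h *: (c *: e_ i)).
  have Us : U (s0 *: (h *: (c *: e_ i)) + (h *: w + x)).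
    by apply: Hr1; have := small h s0 hs s1; rewrite lt_min => /andP[].
  by do 2!apply: derivable_scale_dir; exact: dF.
have s01' : 0 <= s <= 1 by case/andP: s01 => *; rewrite !ltW.
set y := _ + (h *: w + x).
have yx : `|y - x| < Num.min r1 r2 by exact: small.
have Uy : U y by apply: Hr1; move: yx; rewrite lt_min => /andP[].
have -> : 'D_(h *: (c *: e_ i)) F y = h * c * partial i F y.
  have dFy := dF _ Uy.
  have dFy' := @derivable_scale_dir _ _ F y (e_ i) c dFy.
  rewrite (@derive_scale_dir _ _ F y _ h dFy').
  by rewrite (@derive_scale_dir _ _ F y _ c dFy) mulrA.
rewrite -mulrA mulKf// -mulrBr normrM distrC.
have : `|partial i F y - partial i F x| < e / C.
  by apply: Hr2; move: yx; rewrite lt_min => /andP[].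
rewrite ltr_pdivlMr// => lt1; apply: le_lt_trans lt1.
rewrite mulrC ler_wpM2l// /C -addrA addrCA lerDl; exact: addr_ge0.
Unshelve. all: by end_near. Qed.

(** The increment along [v] is telescoped along the coordinate axes, each step
    being [is_derive_add_dir]; only the partial derivatives are assumed. *)
Lemma is_derive_dir U F x v : open U -> U x -> (forall y i, U y -> derivable F y (e_ i)) ->
  (forall i, {for x, continuous (partial i F)}) ->
  is_derive x v F (\sum_i v ord0 i * partial i F x).
Proof.
move=> oU Ux dF cF; rewrite [X in is_derive _ X](row_sum_delta v).
elim: (index_enum 'I_d) => [|i s IH]; first by rewrite !big_nil; exact: is_derive0.
rewrite !big_cons addrC [X in is_derive _ _ _ X]addrC.
by apply: (is_derive_add_dir _ oU Ux) => // y Uy; exact: dF.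
Qed.

Lemma mixed_mean_value U F x (h : R) i j : 
  (forall s t : R, 0 <= s <= h -> 0 <= t <= h -> U (s *: e_ i + t *: e_ j + x)) ->
  0 < h ->
  (forall y, U y -> derivable F y (e_ i)) ->
  (forall y, U y -> derivable (partial i F) y (e_ j)) ->
  exists s t : R, [/\ 0 <= s <= h, 0 <= t <= h &
    F (h *: e_ i + h *: e_ j + x) - F (h *: e_ i + x) - F (h *: e_ j + x) + F x
    = h ^+ 2 * partial j (partial i F) (s *: e_ i + t *: e_ j + x)].
Proof.
move=> HU h0 dF ddF.
have h0' := ltW h0.
pose G y := F (y + h *: e_ j) - F y.
have dG y : U y -> U (y + h *: e_ j) ->
   is_derive y (e_ i) G (partial i F (y + h *: e_ j) - partial i F y).
  move=> Uy Uy'; apply: is_deriveB; last exact: derivableP (dF _ Uy).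
  have /is_deriveE D := derivableP (dF _ Uy').
  by apply/is_deriveE; move: D; under eq_fun do rewrite addrA.
have sub1 s : 0 <= s <= 1 -> 0 <= s * h <= h.
  by case/andP=> s0 s1; rewrite mulr_ge0//= -[leRHS]mul1r ler_wpM2r.
have U1 s : 0 <= s <= 1 -> U (s *: (h *: e_ i) + x).
  move=> s01; rewrite scalerA -[X in X + x]addr0 -(scale0r (e_ j)).
  by apply: HU; [exact: sub1|rewrite lexx h0'].
have U2 s : 0 <= s <= 1 -> U (s *: (h *: e_ i) + x + h *: e_ j).
  move=> s01; rewrite addrAC scalerA.
  by apply: HU; [exact: sub1|rewrite lexx h0'].
have [s s01|s s01] := @mean_value_line R _ G x (h *: e_ i).
  by case: (is_derive_scale_dir h (dG _ (U1 _ s01) (U2 _ s01))).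
have s01' : 0 <= s <= 1 by case/andP: s01 => *; rewrite !ltW.
have [_ ->] := is_derive_scale_dir h (dG _ (U1 _ s01') (U2 _ s01')).
set y := s *: _ + x; rewrite [y + _]addrC.
have U3 t : 0 <= t <= 1 -> U (t *: (h *: e_ j) + y).
  move=> t01; rewrite /y addrA !scalerA [X in X + x]addrC.
  by apply: HU; exact: sub1.
have [t t01|t t01 ->] := @mean_value_line R _ (partial i F) y (h *: e_ j).
  by case: (is_derive_scale_dir h (derivableP (ddF _ (U3 _ t01)))).
have t01' : 0 <= t <= 1 by case/andP: t01 => *; rewrite !ltW.
have [_ ->] := is_derive_scale_dir h (derivableP (ddF _ (U3 _ t01'))).
rewrite /G => E.
exists (s * h), (t * h); split; [exact: sub1|exact: sub1|].
rewrite -!scalerA.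
have -> : s *: (h *: e_ i) + t *: (h *: e_ j) + x = t *: (h *: e_ j) + y.
  by rewrite /y addrA; congr (_ + x); rewrite addrC.
rewrite expr2 -mulrA /partial -E -/y [x + _]addrC [h *: e_ i + x + _]addrAC.
by ring.
Qed.

(** Symmetry of second derivatives: the second difference of [F] over a small
    square is [h ^ 2] times either mixed derivative at some point of it. *)
Lemma partialC U F x i j : open U -> U x ->
  (forall y k, U y -> derivable F y (e_ k)) ->
  (forall k y l, U y -> derivable (partial k F) y (e_ l)) ->
  (forall k l, {for x, continuous (partial k (partial l F))}) ->
  partial j (partial i F) x = partial i (partial j F) x.
Proof.
move=> oU Ux dF ddF cF.
apply/eqP; rewrite -subr_eq0 -normr_le0; apply/ler_addgt0Pr => e e0.
rewrite add0r.
have e20 : 0 < e / 2 by rewrite divr_gt0.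
have [r0 r00 Hr0] := near_ball_open oU Ux.
have [r1 r10 Hr1] := continuous_ball (cF j i) e20.
have [r2 r20 Hr2] := continuous_ball (cF i j) e20.
pose r := Num.min r0 (Num.min r1 r2).
have r_gt0 : 0 < r by rewrite !lt_min r00 r10.
pose h := r / 3.
have h0 : 0 < h by rewrite divr_gt0.
have small (k l : 'I_d) (s t : R) : 0 <= s <= h -> 0 <= t <= h ->
    `|s *: e_ k + t *: e_ l + x - x| < r.
  move=> /andP[s0 sh] /andP[t0 th]; rewrite addrK.
  rewrite (le_lt_trans (ler_normD _ _))// !normrZ !ger0_norm//.
  apply: (@le_lt_trans _ _ (s * 1 + t * 1)).
    by apply: lerD; rewrite ler_wpM2l// norm_delta.
  have : r = h * 3 by rewrite /h divfK.
  by lra.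
have inU (k l : 'I_d) (s t : R) : 0 <= s <= h -> 0 <= t <= h -> U (s *: e_ k + t *: e_ l + x).
  by move=> sh th; apply: Hr0; have := small k l s t sh th; rewrite lt_min => /andP[].
have [s [t [sh th E1]]] := @mixed_mean_value U F x h i j (inU i j) h0
  (fun y Uy => dF y _ Uy) (fun y Uy => ddF _ y _ Uy).
have [s' [t' [sh' th' E2]]] := @mixed_mean_value U F x h j i (inU j i) h0
  (fun y Uy => dF y _ Uy) (fun y Uy => ddF _ y _ Uy).
have : partial j (partial i F) (s *: e_ i + t *: e_ j + x) =
       partial i (partial j F) (s' *: e_ j + t' *: e_ i + x).
  apply: (@mulfI _ (h ^+ 2)); first by rewrite sqrf_eq0 gt_eqF.
  apply: etrans (etrans (esym E1) _) E2.
  by rewrite [h *: e_ j + h *: e_ i]addrC; congr (_ + F x); exact: addrAC.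
have := small i j s t sh th; rewrite !lt_min => /and3P[_ /Hr1 + _].
have := small j i s' t' sh' th'; rewrite !lt_min => /and3P[_ _ /Hr2].
move: (partial j (partial i F) x) (partial i (partial j F) x) => a b.
move: (partial j (partial i F) _) (partial i (partial j F) _) => a' b' H2 H1 eab.
rewrite eab in H1; have -> : a - b = - (b' - a) + (b' - b) by ring.
rewrite (le_trans (ler_normD _ _))// normrN [e](splitr e) lerD// ltW//.
Qed.

Lemma near_open U x (P : E -> Prop) : open U -> U x -> (forall y, U y -> P y) ->
  \forall y \near x, P y.
Proof. by move=> oU Ux UP; apply: filterS UP _; exact: open_nbhs_nbhs. Qed.

End partials.

(** Sealed copies of the partial derivative and of the associated predicates:
    otherwise unification would unfold them down to limits along filters. *)
HB.lock Definition pd (R : realType) d (i : 'I_d) (F : 'rV[R]_d -> R) :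
  'rV[R]_d -> R := partial i F.
HB.lock Definition pderivable (R : realType) d (i : 'I_d) (F : 'rV[R]_d -> R)
  (x : 'rV[R]_d) : Prop := derivable F x (delta_mx ord0 i).
HB.lock Definition has_pd (R : realType) d (i : 'I_d) (F : 'rV[R]_d -> R)
  (x : 'rV[R]_d) (l : R) : Prop := is_derive x (delta_mx ord0 i : 'rV[R]_d) F l.

Section sealed.
Variables (R : realType) (d : nat).
Local Notation E := 'rV[R]_d.
Implicit Types (F G : E -> R) (x y : E) (U : set E) (i j : 'I_d).
Local Notation e_ i := (delta_mx ord0 i : E).

Lemma pdE i F : pd i F = partial i F. Proof. by rewrite unlock. Qed.

Lemma pderivableE i F x : pderivable i F x = derivable F x (e_ i).
Proof. by rewrite unlock. Qed.

Lemma has_pdE i F x (l : R) : has_pd i F x l = is_derive x (e_ i) F l.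
Proof. by rewrite unlock. Qed.

Definition partially_derivable U F := forall x, U x ->
  forall i, pderivable i F x.

Lemma pderivableP F x i : pderivable i F x -> has_pd i F x (pd i F x).
Proof. by rewrite pderivableE has_pdE pdE; exact: derivableP. Qed.

Lemma has_pd_derivable F x i l : has_pd i F x l -> pderivable i F x.
Proof. by rewrite pderivableE has_pdE; case. Qed.

Lemma has_pd_val F x i l : has_pd i F x l -> pd i F x = l.
Proof. by rewrite pdE has_pdE; case. Qed.

Lemma pd_ext U F G x i : open U -> U x -> (forall y, U y -> F y = G y) ->
  pd i F x = pd i G x.
Proof. by move=> oU Ux FG; rewrite !pdE; apply: near_eq_derive; exact: near_open FG. Qed.

Lemma continuous_ext_on U F G x : open U -> U x -> (forall y, U y -> F y = G y) ->
  {for x, continuous F} -> {for x, continuous G}.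
Proof.
move=> oU Ux FG cF; have nFG := near_open oU Ux FG.
have : G y @[y --> x] --> F x by exact: cvg_trans (near_eq_cvg nFG) cF.
by rewrite FG.
Qed.

Lemma pdD F G x i : pderivable i F x -> pderivable i G x ->
  pd i (fun y => F y + G y) x = pd i F x + pd i G x.
Proof. by rewrite !pderivableE !pdE; exact: deriveD. Qed.

Lemma pdM F G x i : pderivable i F x -> pderivable i G x ->
  pd i (fun y => F y * G y) x = pd i F x * G x + F x * pd i G x.
Proof. rewrite !pderivableE !pdE => dF dG.
apply: etrans (deriveM dF dG) (etrans (addrC _ _) _).
by congr (_ + _); exact: mulrC. Qed.

Lemma pd_cst c x i : pd i (cst c) x = 0.
Proof. by rewrite pdE; exact: derive_cst. Qed.

Lemma pderivable_ext U F G x i : open U -> U x -> (forall y, U y -> F y = G y) ->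
  pderivable i F x -> pderivable i G x.
Proof.
move=> oU Ux FG; rewrite !pderivableE; apply: near_eq_derivable.
exact: near_open FG.
Qed.

Lemma pderivable_cst c x i : pderivable i (cst c) x.
Proof. by rewrite !pderivableE; exact: derivable_cst. Qed.

Lemma pderivableD F G x i : pderivable i F x -> pderivable i G x ->
  pderivable i (fun y => F y + G y) x.
Proof. by rewrite !pderivableE; exact: derivableD. Qed.

Lemma pderivableM F G x i : pderivable i F x -> pderivable i G x ->
  pderivable i (fun y => F y * G y) x.
Proof. by rewrite !pderivableE; exact: derivableM. Qed.

Lemma has_pd_comp (phi : R -> R) F x i (a b : R) :
  is_derive (F x) (1 : R) phi a -> has_pd i F x b ->
  has_pd i (phi \o F) x (a * b).
Proof. by rewrite !has_pdE; exact: is_derive_compr. Qed.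

Lemma has_pd_sum (m : nat) (F : 'I_m -> E -> R) x i (l : 'I_m -> R) :
  (forall k, has_pd i (F k) x (l k)) ->
  has_pd i (fun y => \sum_k F k y) x (\sum_k l k).
Proof.
move=> D; rewrite has_pdE.
have {}D k : is_derive x (e_ i) (F k) (l k) by rewrite -has_pdE.
have := @is_derive_sum R E R^o m F x (e_ i) _ D.
by rewrite (_ : \sum_k F k = fun y => \sum_k F k y)//; apply/funext => y; rewrite fct_sumE.
Qed.

Lemma has_pd_sqr F x i (l : R) : has_pd i F x l ->
  has_pd i (fun y => F y ^+ 2) x (2 * F x * l).
Proof.
by rewrite !has_pdE => D; have := @is_deriveX _ _ F 2 x (e_ i) _ D; rewrite /= expr1.
Qed.

Lemma pd_scale F x i c : pderivable i F x ->
  pd i (fun y => c * F y) x = c * pd i F x.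
Proof. by rewrite !pderivableE !pdE; exact: deriveZ. Qed.

Lemma has_pd_coord x i j : has_pd i (fun y : E => y ord0 j) x (i == j)%:R.
Proof.
rewrite has_pdE; apply/is_deriveE; apply: cvg_near_cst; near=> h.
have h0 : h != 0 by near: h; exact: nbhs_dnbhs_neq.
by rewrite !mxE eqxx eq_sym addrK mulKf.
Unshelve. all: by end_near. Qed.

Lemma pdC U F x i j : open U -> U x ->
  partially_derivable U F ->
  (forall k, partially_derivable U (pd k F)) ->
  (forall k l, {for x, continuous (pd k (pd l F))}) ->
  pd j (pd i F) x = pd i (pd j F) x.
Proof.
move=> oU Ux dF ddF cF; rewrite !pdE; apply: (@partialC _ _ U F x i j oU Ux).
- by move=> y k Uy; rewrite -pderivableE; exact: dF.
- by move=> k y l Uy; rewrite -pderivableE -pdE; exact: ddF.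
- by move=> k l; rewrite -!pdE; exact: cF.
Qed.

Fixpoint class_C k U F : Prop :=
  (forall x, U x -> {for x, continuous F}) /\
  if k is k'.+1 then
    partially_derivable U F /\ forall i, class_C k' U (pd i F)
  else True.

Lemma foldr_pd F s : foldr (@partial R d) F s = foldr (@pd R d) F s.
Proof. by elim: s => //= i s ->; rewrite pdE. Qed.

Lemma class_CW k U F : class_C k.+1 U F -> class_C k U F.
Proof.
elim: k F => [|k IH] F [cF [dF pF]]; first by split.
by split=> //; split=> // i; apply: IH.
Qed.

Lemma class_C_ext k U F G : open U -> (forall y, U y -> F y = G y) ->
  class_C k U F -> class_C k U G.
Proof.
move=> oU; elim: k F G => [|k IH] F G FG [cF pF].
  by split=> // x Ux; apply: (continuous_ext_on oU Ux FG); exact: cF.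
split; first by move=> x Ux; apply: (continuous_ext_on oU Ux FG); exact: cF.
case: pF => dF pF; split=> [x Ux i|i].
  exact: (pderivable_ext oU Ux FG (dF _ Ux i)).
by apply: IH (pF i) => x Ux; exact: (pd_ext i oU Ux FG).
Qed.

Lemma class_CD k U F G : open U -> class_C k U F -> class_C k U G ->
  class_C k U (fun y => F y + G y).
Proof.
move=> oU; elim: k F G => [|k IH] F G [cF pF] [cG pG].
  by split=> // x Ux; apply: continuousD; [exact: cF|exact: cG].
split; first by move=> x Ux; apply: continuousD; [exact: cF|exact: cG].
case: pF pG => dF pF [dG pG]; split=> [x Ux i|i].
  by apply: pderivableD; [exact: dF|exact: dG].
apply: class_C_ext (IH _ _ (pF i) (pG i)) => // x Ux.
by rewrite pdD//; [exact: dF|exact: dG].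
Qed.

Lemma class_CM k U F G : open U -> class_C k U F -> class_C k U G ->
  class_C k U (fun y => F y * G y).
Proof.
move=> oU; elim: k F G => [|k IH] F G CF CG.
  by split=> // x Ux; apply: continuousM; [exact: CF.1|exact: CG.1].
have CF' := class_CW CF; have CG' := class_CW CG.
case: CF CG => cF [dF pF] [cG [dG pG]].
split; first by move=> x Ux; apply: continuousM; [exact: cF|exact: cG].
split=> [x Ux i|i]; first by apply: pderivableM; [exact: dF|exact: dG].
apply: class_C_ext (class_CD oU (IH _ _ (pF i) CG') (IH _ _ CF' (pG i))) => //.
by move=> x Ux; rewrite pdM//; [exact: dF|exact: dG].
Qed.

Lemma class_C_cst k U c : class_C k U (cst c).
Proof.
elim: k c => [|k IH] c /=; first by split=> // x _; exact: cst_continuous.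
split; first by move=> x _; exact: cst_continuous.
split=> [x _ i|i]; first exact: pderivable_cst.
by rewrite (_ : pd i _ = cst 0)//; apply/funext => x; exact: pd_cst.
Qed.

(** The family [Phi] is stable under derivation on [D], so that the chain rule can
    be iterated without computing the higher derivatives of [phi]. *)
Lemma class_C_comp k U (D : set R) (Phi : set (R -> R)) phi F : open U ->
  (forall phi, Phi phi -> exists2 phi', Phi phi' &
     forall r : R, D r -> is_derive r (1 : R) phi (phi' r)) ->
  (forall x, U x -> D (F x)) -> Phi phi ->
  class_C k U F -> class_C k U (phi \o F).
Proof.
move=> oU HPhi UD; elim: k phi => [|k IH] phi Pphi CF;
  have [phi' Pphi' dphi] := HPhi _ Pphi;
  have cphi x : U x -> {for F x, continuous phi} by
    move=> Ux; have [dp _] := dphi _ (UD _ Ux);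
    exact/differentiable_continuous/derivable1_diffP.
- split=> // x Ux; apply: continuous_comp; first exact: CF.1.
  exact: cphi.
- have CF' := class_CW CF.
  case: CF => cF [dF pF].
  have D1 x i : U x -> has_pd i (phi \o F) x (phi' (F x) * pd i F x).
    move=> Ux; apply: has_pd_comp; first exact: dphi (UD _ Ux).
    exact: pderivableP (dF _ Ux i).
  split; first by move=> x Ux; apply: continuous_comp; [exact: cF|exact: cphi].
  split=> [x Ux i|i]; first exact: has_pd_derivable (D1 x i Ux).
  apply: class_C_ext (class_CM oU (IH _ Pphi' CF') (pF i)) => // x Ux.
  by rewrite (has_pd_val (D1 x i Ux)).
Qed.

End sealed.

(** The sealed counterpart of [smooth_on], peeling the innermost derivative
    first, which is the form suited to closure properties. *)
HB.lock Definition smoothU (R : realType) d (U : set 'rV[R]_d) (F : 'rV[R]_d -> R) :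
  Prop := forall k, class_C k U F.

Section smoothU.
Variables (R : realType) (d : nat).
Local Notation E := 'rV[R]_d.
Implicit Types (F G : E -> R) (x y : E) (i j : 'I_d).
Variable U : set E.
Hypothesis oU : open U.

Lemma smoothUP F : smoothU U F <-> forall k, class_C k U F.
Proof. by rewrite unlock. Qed.

Lemma smooth_onE F : smooth_on U F <-> smoothU U F.
Proof.
rewrite smoothUP; split=> [sF k|CF].
  have {}sF s x : U x -> {for x, continuous (foldr (@pd R d) F s)} /\
      forall i, pderivable i (foldr (@pd R d) F s) x.
    move=> Ux; have [] := sF s x Ux; rewrite foldr_pd; split=> // i.
    by rewrite pderivableE.
  elim: k F sF => [|k IH] F sF /=.
    by split=> // x /(sF [::])[].
  split; first by move=> x /(sF [::])[].
  split; first by move=> x /(sF [::])[].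
  by move=> i; apply: IH => s x Ux; have := sF (rcons s i) x Ux; rewrite foldr_rcons.
move=> s; elim/last_ind : s F CF => [|s i IH] F CF x Ux.
  have [/(_ x Ux) cF [/(_ x Ux) dF _]] := CF 1%N; split=> // i.
  by rewrite -pderivableE; exact: dF.
rewrite foldr_rcons -pdE; apply: IH => // k.
by have [_ [_ /(_ i)]] := CF k.+1.
Qed.

Lemma smoothU_ext F G : (forall y, U y -> F y = G y) ->
  smoothU U F -> smoothU U G.
Proof.
by move=> FG /smoothUP sF; apply/smoothUP => k; exact: class_C_ext FG (sF k).
Qed.

Lemma smoothU_continuous F x : smoothU U F -> U x -> {for x, continuous F}.
Proof. by move=> /smoothUP/(_ 0%N)[cF _] Ux; exact: cF. Qed.

Lemma smoothU_derivable F x i : smoothU U F -> U x -> pderivable i F x.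
Proof. by move=> /smoothUP/(_ 1%N)[_ [dF _]] Ux; exact: dF. Qed.

Lemma smoothU_partially_derivable F : smoothU U F -> partially_derivable U F.
Proof. by move=> sF x Ux i; exact: smoothU_derivable. Qed.

Lemma smoothU_pd F i : smoothU U F -> smoothU U (pd i F).
Proof.
move=> /smoothUP sF; apply/smoothUP => k.
by have [_ [_ /(_ i)]] := sF k.+1.
Qed.

Lemma smoothUD F G : smoothU U F -> smoothU U G ->
  smoothU U (fun y => F y + G y).
Proof.
by move=> /smoothUP sF /smoothUP sG; apply/smoothUP => k; exact: class_CD.
Qed.

Lemma smoothUM F G : smoothU U F -> smoothU U G ->
  smoothU U (fun y => F y * G y).
Proof.
by move=> /smoothUP sF /smoothUP sG; apply/smoothUP => k; exact: class_CM.
Qed.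

Lemma smoothU_cst c : smoothU U (cst c).
Proof. by apply/smoothUP => k; exact: class_C_cst. Qed.

Lemma smoothU_sum (I : Type) (r : seq I) (P : pred I) (F : I -> E -> R) :
  (forall k, smoothU U (F k)) -> smoothU U (fun y => \sum_(k <- r | P k) F k y).
Proof.
move=> sF; elim: r => [|i r IH].
  by apply: smoothU_ext (smoothU_cst 0) => y _; rewrite big_nil.
case Pi : (P i); last by apply: smoothU_ext IH => y _; rewrite big_cons Pi.
by apply: smoothU_ext (smoothUD (sF i) IH) => y _; rewrite big_cons Pi.
Qed.

Lemma smoothU_coord j : smoothU U (fun y => y ord0 j).
Proof.
apply/smoothUP; case=> [|k].
  by split=> // x _; exact: coord_continuous.
split; first by move=> x _; exact: coord_continuous.
split=> [x _ i|i]; first exact: has_pd_derivable (has_pd_coord x i j).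
rewrite (_ : pd i _ = cst (i == j)%:R); first exact: class_C_cst.
by apply/funext => x; exact: has_pd_val (has_pd_coord x i j).
Qed.

Lemma smoothU_expR F : smoothU U F -> smoothU U (fun y => expR (F y)).
Proof.
move=> /smoothUP sF; apply/smoothUP => k.
apply: (@class_C_comp _ _ k U setT [set @expR R] (@expR R) F) => //= phi ->.
by exists (@expR R) => // x _; exact: is_derive_expR.
Qed.

Lemma smoothU_powR F (a : R) : (forall x, U x -> 0 < F x) ->
  smoothU U F -> smoothU U (fun y => F y `^ a).
Proof.
move=> F0 /smoothUP sF; apply/smoothUP => k.
pose Phi := [set phi | exists c b : R, phi = fun t : R => c * t `^ b].
apply: (@class_C_comp _ _ k U [set r : R | 0 < r] Phi (fun t : R => t `^ a) F) => //=; last first.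
  by exists 1, a; apply/funext => t; rewrite mul1r.
move=> phi [c [b ->]]; exists (fun t : R => (c * b) * t `^ (b - 1)).
  by exists (c * b), (b - 1).
move=> x x0; rewrite -mulrA.
have := @is_deriveZ _ _ _ (fun t : R => t `^ b) c x 1 _ (is_derive1_powR b x0).
exact.
Qed.

End smoothU.

Section smoothU_dir.
Variables (R : realType) (d : nat).
Local Notation E := 'rV[R]_d.
Implicit Types (F G : E -> R) (x y : E) (U : set E) (i j : 'I_d).
Local Notation e_ i := (delta_mx ord0 i : E).

(** Euler's identity: differentiate [s |-> F (s x) = s ^ a F x] at [s = 1]. *)
Lemma euler_homogeneous U F x (a : R) : open U -> U x -> smoothU U F ->
  (forall s : R, 0 < s -> F (s *: x) = s `^ a * F x) ->
  \sum_i x ord0 i * pd i F x = a * F x.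
Proof.
move=> oU Ux sF hF.
have dF y i : U y -> derivable F y (delta_mx ord0 i : E).
  by move=> Uy; rewrite -pderivableE; exact: smoothU_derivable sF Uy.
have cF i : {for x, continuous (partial i F)}.
  by rewrite -pdE; exact: smoothU_continuous (smoothU_pd i sF) Ux.
have /is_derive_line [_] := is_derive_dir x oU Ux dF cF.
under eq_bigr do rewrite -pdE.
move=> <-.
have : is_derive (0 : R) (1 : R) (fun h : R => (h + 1) `^ a * F x) (a * F x).
  have d1 : is_derive (0 + 1 : R) (1 : R) (fun h : R => h `^ a) a.
    rewrite add0r; have := is_derive1_powR a (@ltr01 R).
    by rewrite powR1 mulr1.
  have d2 := @is_derive1_comp _ (fun h : R => h `^ a) (shift 1) 0 _ _ d1 (is_derive_shift 0 1 1).
  have := @is_deriveM R R^o _ (cst (F x)) 0 1 _ _ d2 (is_derive_cst _ _ _).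
  rewrite scaler0 add0r /GRing.scale /= mulr1 [X in is_derive _ _ _ X]mulrC.
  exact.
case=> _ <-; apply: near_eq_derive; near=> h.
have h1 : 0 < h + 1.
  rewrite -ltrBlDr sub0r; near: h; apply: lt_nbhsr; by rewrite ltrN10.
by rewrite -hF// scalerDl scale1r.
Unshelve. all: by end_near. Qed.

(** Differentiate [F (s x) = s ^ a F x] in the variable [x]. *)
Lemma pd_homogeneous U F x (a s : R) i : open U -> U x -> 0 < s ->
  (forall y, U y -> F (s *: y) = s `^ a * F y) -> pderivable i F x ->
  pd i F (s *: x) = s `^ (a - 1) * pd i F x.
Proof.
move=> oU Ux s0 hF dF; apply: has_pd_val.
have sN0 : s != 0 by rewrite gt_eqF.
have -> : s `^ (a - 1) * pd i F x = s `^ a * (s^-1 * pd i F x).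
  by rewrite powRD ?sN0 ?implybT// powR_inv1 ?ltW// mulrA.
have D : is_derive x (s^-1 *: e_ i) F (s^-1 * pd i F x).
  by apply: is_derive_scale_dir; rewrite -has_pdE; exact: pderivableP.
have D1 := @is_deriveZ _ _ _ F (s `^ a) x _ _ D.
have near_x := near_open oU Ux (fun y Uy => esym (hF y Uy)).
have /is_deriveE H := near_eq_is_derive near_x D1.
rewrite has_pdE; apply/is_deriveE; apply: cvg_trans H; apply: near_eq_cvg; near=> h => /=.
by rewrite scalerDr !scalerA mulrAC divff// mul1r.
Unshelve. all: by end_near. Qed.

End smoothU_dir.

(** * Functions on the sphere and their homogeneous extensions *)

Section euclidean.
Variables (R : realType) (d : nat).
Local Notation E := 'rV[R]_d.
Implicit Types (F G : E -> R) (x y z : E) (i j : 'I_d).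
Local Notation e_ i := (delta_mx ord0 i : E).

Definition nonzero : set E := [set z | z != 0].
Definition sqnorm z : R := \sum_i z ord0 i ^+ 2.
Definition normpow (b : R) z : R := enorm z `^ b.
Definition homogeneous (b : R) G := forall (s : R) z, 0 < s -> z != 0 ->
  G (s *: z) = s `^ b * G z.
Definition laplacian G z : R := \sum_i pd i (pd i G) z.
Definition dotgrad F G z : R := \sum_i pd i F z * pd i G z.

Lemma open_nonzero : open nonzero.
Proof.
rewrite (_ : nonzero = ~` [set 0]); last first.
  by apply/seteqP; split => z /= /eqP.
by apply: closed_openC; apply: accessible_closed_set1; exact/hausdorff_accessible/norm_hausdorff.
Qed.
Local Notation oU := open_nonzero.

Lemma nonzero_continuous F z : smoothU nonzero F -> z != 0 ->
  {for z, continuous F}.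
Proof. by move=> sF z0; exact: (smoothU_continuous sF). Qed.

Lemma nonzero_derivable F z i : smoothU nonzero F -> z != 0 ->
  pderivable i F z.
Proof. by move=> sF z0; exact: (smoothU_derivable i sF z0). Qed.

Lemma sqnorm_ge0 z : 0 <= sqnorm z.
Proof. by apply: sumr_ge0 => i _; exact: sqr_ge0. Qed.

Lemma enorm_sqr z : enorm z ^+ 2 = sqnorm z.
Proof. by rewrite sqr_sqrtr// sqnorm_ge0. Qed.

Lemma enorm_ge0 z : 0 <= enorm z. Proof. exact: sqrtr_ge0. Qed.

Lemma sqnorm_eq0 z : (sqnorm z == 0) = (z == 0).
Proof.
rewrite psumr_eq0; last by move=> i _; exact: sqr_ge0.
apply/allP/eqP => [H|-> i _ /=]; last by rewrite mxE expr0n.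
apply/rowP => i; have := H i (mem_index_enum _).
by rewrite sqrf_eq0 mxE => /eqP.
Qed.

Lemma sqnorm_gt0 z : z != 0 -> 0 < sqnorm z.
Proof. by move=> z0; rewrite lt_neqAle sqnorm_ge0 eq_sym sqnorm_eq0 z0. Qed.

Lemma enorm_gt0 z : z != 0 -> 0 < enorm z.
Proof. by move=> z0; rewrite sqrtr_gt0; exact: sqnorm_gt0. Qed.

Lemma enormZ (a : R) z : enorm (a *: z) = `|a| * enorm z.
Proof.
rewrite /enorm; under eq_bigr do rewrite mxE exprMn.
by rewrite -mulr_sumr sqrtrM ?sqr_ge0// sqrtr_sqr.
Qed.

Lemma smoothU_sqnorm U : open U -> smoothU U sqnorm.
Proof.
move=> oV; apply: smoothU_sum => // i.
apply: (@smoothU_ext _ _ _ oV (fun z => z ord0 i * z ord0 i)) => //.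
by apply: smoothUM => //; exact: smoothU_coord.
Qed.

Lemma normpowE b z : normpow b z = sqnorm z `^ (b / 2).
Proof. by rewrite /normpow /enorm -powR12_sqrt ?sqnorm_ge0// -powRrM mulrC. Qed.

Lemma smoothU_normpow b : smoothU nonzero (normpow b).
Proof.
apply: (@smoothU_ext _ _ _ oU (fun z => sqnorm z `^ (b / 2))).
  by move=> z _; rewrite normpowE.
apply: smoothU_powR; [exact: oU|exact: sqnorm_gt0|].
exact: smoothU_sqnorm oU.
Qed.

Lemma normpowD b c z : z != 0 -> normpow (b + c) z = normpow b z * normpow c z.
Proof. by move=> z0; rewrite /normpow powRD// (gt_eqF (enorm_gt0 z0)) implybT. Qed.

Lemma normpow2 z : z != 0 -> normpow 2 z = sqnorm z.
Proof. by move=> z0; rewrite /normpow (powR_mulrn 2) ?enorm_ge0// enorm_sqr. Qed.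

Lemma homogeneous_normpow b : homogeneous b (normpow b).
Proof.
move=> s z s0 z0; rewrite /normpow enormZ gtr0_norm//.
by rewrite powRM ?(ltW s0) ?enorm_ge0.
Qed.

Lemma has_pd_sqnorm z i : has_pd i sqnorm z (2 * z ord0 i).
Proof.
have := has_pd_sum (fun j => has_pd_sqr (has_pd_coord z i j)).
rewrite (bigD1 i)//= eqxx mulr1 big1 ?addr0// => j ji.
by rewrite eq_sym (negbTE ji) mulr0.
Qed.

Lemma pd_normpow b z i : z != 0 ->
  pd i (normpow b) z = b * z ord0 i * normpow (b - 2) z.
Proof.
move=> z0; apply: has_pd_val.
have D := has_pd_comp (is_derive1_powR (b / 2) (sqnorm_gt0 z0)) (has_pd_sqnorm z i).
have -> : normpow b = (fun t => t `^ (b / 2)) \o sqnorm.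
  by apply/funext => y; rewrite normpowE.
move: D; congr has_pd; rewrite normpowE.
have -> : (b - 2) / 2 = b / 2 - 1 by rewrite mulrBl divff.
by field.
Qed.

Lemma homogeneousM F G b c : homogeneous b F -> homogeneous c G ->
  homogeneous (b + c) (fun z => F z * G z).
Proof.
move=> hF hG s z s0 z0; rewrite hF// hG// powRD; last by rewrite (gt_eqF s0) implybT.
by rewrite mulrACA.
Qed.

Lemma homogeneous_sum (I : Type) (r : seq I) (F : I -> E -> R) b :
  (forall k, homogeneous b (F k)) -> homogeneous b (fun z => \sum_(k <- r) F k z).
Proof.
by move=> hF s z s0 z0; rewrite mulr_sumr; apply: eq_bigr => k _; exact: hF.
Qed.

Lemma homogeneous_pd G b i : smoothU nonzero G -> homogeneous b G ->
  homogeneous (b - 1) (pd i G).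
Proof.
move=> sG hG s z s0 z0; apply: (pd_homogeneous oU) => //.
  by move=> y y0; exact: hG.
exact: nonzero_derivable sG z0.
Qed.

Lemma euler G b z : smoothU nonzero G -> homogeneous b G -> z != 0 ->
  \sum_i z ord0 i * pd i G z = b * G z.
Proof.
move=> sG hG z0; apply: (@euler_homogeneous _ _ _ G z b oU z0 sG) => s s0.
exact: hG.
Qed.

Lemma smoothU_laplacian G : smoothU nonzero G -> smoothU nonzero (laplacian G).
Proof.
move=> sG; apply: smoothU_sum; first exact: oU.
by move=> i; do 2!apply: smoothU_pd.
Qed.

Lemma homogeneous_laplacian G b : smoothU nonzero G -> homogeneous b G ->
  homogeneous (b - 2) (laplacian G).
Proof.
move=> sG hG; rewrite (_ : b - 2 = b - 1 - 1); last by ring.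
apply: homogeneous_sum => i; apply: homogeneous_pd.
  exact: smoothU_pd.
exact: homogeneous_pd.
Qed.

Lemma laplacian_ext F G z : z != 0 -> (forall y, y != 0 -> F y = G y) ->
  laplacian F z = laplacian G z.
Proof.
move=> z0 FG; apply: eq_bigr => i _; apply: (pd_ext i oU) => // y y0.
exact: (pd_ext i oU).
Qed.

(** Third-order partial derivatives commute. *)
Lemma pd_laplacian G z i : z != 0 -> smoothU nonzero G ->
  laplacian (pd i G) z = pd i (laplacian G) z.
Proof.
move=> z0 sG; apply/esym/has_pd_val.
have C H k : smoothU nonzero H -> forall y, y != 0 ->
    pd k (pd i H) y = pd i (pd k H) y.
  move=> sH y y0; apply: (pdC i k oU y0) => [|l|l m].
  - exact: smoothU_partially_derivable.
  - by apply: smoothU_partially_derivable; exact: smoothU_pd.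
  - by apply: nonzero_continuous => //; do 2!apply: smoothU_pd.
have D k : has_pd i (pd k (pd k G)) z
    (pd k (pd k (pd i G)) z).
  have -> : pd k (pd k (pd i G)) z = pd i (pd k (pd k G)) z.
    rewrite -C//; last exact: smoothU_pd.
    by apply: (pd_ext k oU z0) => y y0; exact: C.
  apply: pderivableP; apply: nonzero_derivable z0.
  by do 2!apply: smoothU_pd.
exact: has_pd_sum D.
Qed.

Lemma laplacianM F G z : smoothU nonzero F -> smoothU nonzero G -> z != 0 ->
  laplacian (fun y => F y * G y) z =
  F z * laplacian G z + G z * laplacian F z + 2 * dotgrad F G z.
Proof.
move=> sF sG z0; rewrite !mulr_sumr -!big_split/=; apply: eq_bigr => i _.
have dF y : y != 0 -> pderivable i F y by exact: nonzero_derivable.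
have dG y : y != 0 -> pderivable i G y by exact: nonzero_derivable.
have ddF : pderivable i (pd i F) z.
  by apply: nonzero_derivable z0; exact: smoothU_pd.
have ddG : pderivable i (pd i G) z.
  by apply: nonzero_derivable z0; exact: smoothU_pd.
transitivity (pd i (fun y => pd i F y * G y + F y * pd i G y) z).
  by apply: (pd_ext i oU z0) => y y0; rewrite pdM//; [exact: dF|exact: dG].
rewrite pdD; first by rewrite (pdM ddF (dG _ z0)) (pdM (dF _ z0) ddG); ring.
  by apply: pderivableM; [exact: ddF|exact: dG].
by apply: pderivableM; [exact: dF|exact: ddG].
Qed.

Lemma laplacian_scale F z c : smoothU nonzero F -> z != 0 ->
  laplacian (fun y => c * F y) z = c * laplacian F z.
Proof.
move=> sF z0; rewrite mulr_sumr; apply: eq_bigr => i _.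
rewrite -pd_scale; last first.
  by apply: nonzero_derivable z0; exact: smoothU_pd.
apply: (pd_ext i oU z0) => y y0; apply: pd_scale.
exact: nonzero_derivable y0.
Qed.

Lemma laplacianD F G z : smoothU nonzero F -> smoothU nonzero G -> z != 0 ->
  laplacian (fun y => F y + G y) z = laplacian F z + laplacian G z.
Proof.
move=> sF sG z0; rewrite -big_split/=; apply: eq_bigr => i _.
rewrite -pdD; last 2 first.
- by apply: nonzero_derivable z0; exact: smoothU_pd.
- by apply: nonzero_derivable z0; exact: smoothU_pd.
apply: (pd_ext i oU z0) => y y0; apply: pdD.
- exact: nonzero_derivable y0.
- exact: nonzero_derivable y0.
Qed.

Lemma pd_expR F z i : pderivable i F z ->
  pd i (fun y => expR (F y)) z = expR (F z) * pd i F z.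
Proof.
move=> dF; apply: has_pd_val.
exact: has_pd_comp (is_derive_expR _) (pderivableP dF).
Qed.

Lemma laplacian_expR F z : smoothU nonzero F -> z != 0 ->
  laplacian (fun y => expR (F y)) z =
  expR (F z) * (laplacian F z + dotgrad F F z).
Proof.
move=> sF z0; rewrite -big_split/= mulr_sumr; apply: eq_bigr => i _.
have dF y : y != 0 -> pderivable i F y by exact: nonzero_derivable.
have ddF : pderivable i (pd i F) z.
  by apply: nonzero_derivable z0; exact: smoothU_pd.
transitivity (pd i (fun y => expR (F y) * pd i F y) z).
  by apply: (pd_ext i oU z0) => y y0; rewrite pd_expR//; exact: dF.
rewrite pdM//; last first.
  by apply: nonzero_derivable z0; exact: (smoothU_expR oU).
by rewrite pd_expR; [ring|exact: dF].
Qed.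

Lemma laplacian_normpow b z : z != 0 ->
  laplacian (normpow b) z = b * (b + d%:R - 2) * normpow (b - 2) z.
Proof.
move=> z0; have N0 c : smoothU nonzero (normpow c) by exact: smoothU_normpow.
have D i : pd i (pd i (normpow b)) z =
    b * normpow (b - 2) z + b * (b - 2) * normpow (b - 2 - 2) z * z ord0 i ^+ 2.
  transitivity (pd i (fun y => b * (y ord0 i * normpow (b - 2) y)) z).
    by apply: (pd_ext i oU z0) => y y0; rewrite pd_normpow// mulrA.
  have dz := has_pd_derivable (has_pd_coord z i i).
  have dN := nonzero_derivable i (N0 (b - 2)) z0.
  rewrite pd_scale; last exact: pderivableM.
  have dz1 : pd i (fun y => y ord0 i) z = 1.
    by rewrite (has_pd_val (has_pd_coord z i i)) eqxx.
  by rewrite (pdM dz dN) dz1 pd_normpow//; ring.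
rewrite /laplacian; under eq_bigr do rewrite D.
rewrite big_split/= sumr_const card_ord -mulr_sumr -/(sqnorm z) -normpow2//.
rewrite -[X in _ + X]mulrA -normpowD// subrK -mulr_natr.
by ring.
Qed.

Lemma dotgrad_normpow b c G z : smoothU nonzero G -> homogeneous c G -> z != 0 ->
  dotgrad (normpow b) G z = b * c * normpow (b - 2) z * G z.
Proof.
move=> sG hG z0.
have D i : pd i (normpow b) z * pd i G z =
    b * normpow (b - 2) z * (z ord0 i * pd i G z).
  by rewrite pd_normpow//; ring.
rewrite /dotgrad; under eq_bigr do rewrite D.
by rewrite -mulr_sumr (euler sG hG z0); ring.
Qed.

End euclidean.

(** Sealed for the same reason as [pd]. *)
HB.lock Definition Cinfty (R : realType) n (f : sphere R n -> R) : Prop := smooth f.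

HB.lock Definition lap (R : realType) n (f : sphere R n -> R) : sphere R n -> R :=
  lap0 f.

Section sphere_functions.
Variables (R : realType) (n : nat).
Local Notation E := 'rV[R]_n.+1.
Local Notation S := (sphere R n).
Local Notation nonzero := (@nonzero R n.+1).
Implicit Types (f g u v : S -> R) (x : S) (z : E) (F G : E -> R) (b c : R).

Lemma enorm_val x : enorm (val x) = 1.
Proof. exact/eqP/(valP x). Qed.

Lemma val_neq0 x : val x != 0.
Proof.
apply/eqP => x0; have := enorm_val x; rewrite x0 /enorm big1 ?sqrtr0.
  by move=> e; have := oner_neq0 R; rewrite e eqxx.
by move=> i _; rewrite mxE expr0n.
Qed.

Lemma normpow_val b x : normpow b (val x) = 1.
Proof. by rewrite /normpow enorm_val powR1. Qed.

Lemma val_radial z : z != 0 -> val (radial z) = (enorm z)^-1 *: z.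
Proof.
move=> z0; have z1 := enorm_gt0 z0.
rewrite /radial val_insubd enormZ gtr0_norm ?invr_gt0// mulVf ?eqxx//.
by rewrite gt_eqF.
Qed.

Lemma radialZ (s : R) z : 0 < s -> radial (s *: z) = radial z.
Proof.
move=> s0; have [->|z0] := eqVneq z 0; first by rewrite scaler0.
apply/val_inj; rewrite !val_radial//; last by rewrite scaler_eq0 negb_or gt_eqF.
rewrite enormZ gtr0_norm// scalerA invfM mulrAC mulVf ?mul1r//.
by rewrite gt_eqF.
Qed.

Lemma radial_val x : radial (val x) = x.
Proof. by apply/val_inj; rewrite val_radial ?val_neq0// enorm_val invr1 scale1r. Qed.

Lemma ray_ext_val f x : ray_ext f (val x) = f x.
Proof. by rewrite /ray_ext /= radial_val. Qed.

Lemma homogeneous_ray_ext f : homogeneous 0 (ray_ext f).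
Proof. by move=> s z s0 z0; rewrite /ray_ext /= radialZ// powRr0 mul1r. Qed.

Lemma CinftyE f : Cinfty f <-> smooth f.
Proof. by rewrite unlock. Qed.

Lemma smoothE f : Cinfty f <-> smoothU nonzero (ray_ext f).
Proof. by rewrite unlock; exact: smooth_onE. Qed.

Lemma ray_ext_homogeneous G b z : homogeneous b G -> z != 0 ->
  ray_ext (fun x => G (val x)) z = normpow (- b) z * G z.
Proof.
move=> hG z0; rewrite /ray_ext /= val_radial//.
have z1 := enorm_gt0 z0.
by rewrite hG ?invr_gt0// /normpow -powR_inv1 ?ltW// -powRrM mulN1r.
Qed.

Lemma smooth_homogeneous G b : smoothU nonzero G -> homogeneous b G ->
  Cinfty (fun x => G (val x)).
Proof.
move=> sG hG; apply/smoothE; have oU := @open_nonzero R n.+1.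
apply: (@smoothU_ext _ _ _ oU (fun z => normpow (- b) z * G z)) => [z z0|].
  by rewrite (ray_ext_homogeneous hG z0).
exact: (smoothUM oU (@smoothU_normpow _ _ (- b)) sG).
Qed.

Lemma grad0E f x i : grad0 f x ord0 i = pd i (ray_ext f) (val x).
Proof. by rewrite mxE pdE. Qed.

Lemma homogeneous_pd_ray_ext f i : Cinfty f ->
  homogeneous (-1) (pd i (ray_ext f)).
Proof.
move=> /smoothE sf; have := homogeneous_pd i sf (homogeneous_ray_ext f).
by rewrite sub0r.
Qed.

Lemma smooth_grad0 f i : Cinfty f -> Cinfty (fun x => grad0 f x ord0 i).
Proof.
move=> sf; have hf := homogeneous_pd_ray_ext i sf.
rewrite (_ : (fun x => _) = fun x => pd i (ray_ext f) (val x)); last first.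
  by apply/funext => x; rewrite grad0E.
by apply: smooth_homogeneous hf; apply: smoothU_pd; exact/smoothE.
Qed.

(** The field [grad0 f] is to be extended with degree [0], while the gradient of
    the extension of [f] has degree [-1]: the correction factor [|z|] contributes a
    radial derivative, which vanishes by Euler's identity. *)
Lemma lapE f x : Cinfty f -> lap f x = - laplacian (ray_ext f) (val x).
Proof.
move=> sf; have sF : smoothU nonzero (ray_ext f) by exact/smoothE.
have x0 := val_neq0 x; have oU := @open_nonzero R n.+1.
rewrite unlock /lap0 /div0; congr (- _).
have E i : partial i (ray_ext (fun y => grad0 f y ord0 i)) (val x) =
    val x ord0 i * pd i (ray_ext f) (val x) + pd i (pd i (ray_ext f)) (val x).
  rewrite -pdE.
  transitivity (pd i (fun z => normpow 1 z * pd i (ray_ext f) z) (val x)).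
    apply: (pd_ext i oU x0) => y y0.
    rewrite (_ : (fun y => _) = fun x => pd i (ray_ext f) (val x)); last first.
      by apply/funext => z; rewrite grad0E.
    rewrite (ray_ext_homogeneous (homogeneous_pd_ray_ext i sf))// opprK.
    by [].
  have dN := nonzero_derivable i (@smoothU_normpow R n.+1 1) x0.
  have dF := nonzero_derivable i (smoothU_pd i sF) x0.
  by rewrite (pdM dN dF) pd_normpow// !normpow_val; ring.
under eq_bigr do rewrite E.
by rewrite big_split/= (euler sF (homogeneous_ray_ext f) x0) mul0r add0r.
Qed.

Definition gradprod f g x : R := \sum_i grad0 f x ord0 i * grad0 g x ord0 i.

Lemma gradprodE f g x : gradprod f g x = dotgrad (ray_ext f) (ray_ext g) (val x).
Proof. by apply: eq_bigr => i _; rewrite !grad0E. Qed.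

Lemma smoothD f g : Cinfty f -> Cinfty g -> Cinfty (fun x => f x + g x).
Proof.
by move=> /smoothE sf /smoothE sg; apply/smoothE; exact: (smoothUD (@open_nonzero _ _)).
Qed.

Lemma smoothM f g : Cinfty f -> Cinfty g -> Cinfty (fun x => f x * g x).
Proof.
by move=> /smoothE sf /smoothE sg; apply/smoothE; exact: (smoothUM (@open_nonzero _ _)).
Qed.

Lemma smooth_cst c : Cinfty (cst c : S -> R).
Proof. by apply/smoothE; exact: smoothU_cst. Qed.

Lemma smoothZ c f : Cinfty f -> Cinfty (fun x => c * f x).
Proof. by move=> sf; apply: (smoothM _ sf); exact: smooth_cst. Qed.

Lemma smoothB f g : Cinfty f -> Cinfty g -> Cinfty (fun x => f x - g x).
Proof.
move=> sf sg; rewrite (_ : (fun x => _) = fun x => f x + -1 * g x).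
  by apply: smoothD => //; exact: smoothZ.
by apply/funext => x; rewrite mulN1r.
Qed.

Lemma smooth_sum (I : Type) (r : seq I) (h : I -> S -> R) :
  (forall k, Cinfty (h k)) -> Cinfty (fun x => \sum_(k <- r) h k x).
Proof.
move=> sh; elim: r => [|k r IH].
  rewrite (_ : (fun x => _) = cst 0); first exact: smooth_cst.
  by apply/funext => x; rewrite big_nil.
rewrite (_ : (fun x => _) = fun x => h k x + \sum_(j <- r) h j x).
  exact: smoothD.
by apply/funext => x; rewrite big_cons.
Qed.

Lemma smooth_gradprod f g : Cinfty f -> Cinfty g -> Cinfty (gradprod f g).
Proof. by move=> sf sg; apply: smooth_sum => i; apply: smoothM; exact: smooth_grad0. Qed.

Lemma smooth_lap f : Cinfty f -> Cinfty (lap f).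
Proof.
move=> sf; have sF : smoothU nonzero (ray_ext f) by exact/smoothE.
rewrite (_ : lap f = fun x => -1 * laplacian (ray_ext f) (val x)); last first.
  by apply/funext => x; rewrite lapE// mulN1r.
apply: smoothZ; apply: smooth_homogeneous; first exact: smoothU_laplacian.
exact: homogeneous_laplacian (homogeneous_ray_ext f).
Qed.

Lemma lapD f g x : Cinfty f -> Cinfty g ->
  lap (fun y => f y + g y) x = lap f x + lap g x.
Proof.
move=> sf sg; rewrite !lapE//; last exact: smoothD.
by rewrite -opprD -laplacianD ?val_neq0//; exact/smoothE.
Qed.

Lemma lapZ c f x : Cinfty f -> lap (fun y => c * f y) x = c * lap f x.
Proof.
move=> sf; rewrite !lapE//; last exact: smoothZ.
by rewrite mulrN -laplacian_scale ?val_neq0//; exact/smoothE.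
Qed.

Lemma lapM f g x : Cinfty f -> Cinfty g ->
  lap (fun y => f y * g y) x = f x * lap g x + g x * lap f x - 2 * gradprod f g x.
Proof.
move=> sf sg; rewrite !lapE//; last exact: smoothM.
rewrite gradprodE -(ray_ext_val f x) -(ray_ext_val g x).
have := @laplacianM _ _ (ray_ext f) (ray_ext g) (val x) _ _ (val_neq0 x).
by move=> ->; [ring|exact/smoothE|exact/smoothE].
Qed.

Lemma smooth_expR f : Cinfty f -> Cinfty (fun x => expR (f x)).
Proof.
by move=> /smoothE sf; apply/smoothE; exact: (smoothU_expR (@open_nonzero _ _)).
Qed.

Lemma lap_expR f x : Cinfty f ->
  lap (fun y => expR (f y)) x = expR (f x) * (lap f x - gradprod f f x).
Proof.
move=> sf; rewrite !lapE//; last exact: smooth_expR.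
rewrite gradprodE -(ray_ext_val f x).
have := @laplacian_expR _ _ (ray_ext f) (val x) _ (val_neq0 x).
by move=> ->; [ring|exact/smoothE].
Qed.

Lemma gradprod_expR f g x : Cinfty f -> Cinfty g ->
  gradprod (fun y => expR (f y)) g x = expR (f x) * gradprod f g x.
Proof.
move=> /smoothE sf sg; rewrite !gradprodE mulr_sumr; apply: eq_bigr => i _.
rewrite -(ray_ext_val f x) mulrA; congr (_ * _).
exact: pd_expR (nonzero_derivable i sf (val_neq0 x)).
Qed.

Lemma gradprodZ c f g x : Cinfty f -> 
  gradprod (fun y => c * f y) g x = c * gradprod f g x.
Proof.
move=> /smoothE sf; rewrite !gradprodE mulr_sumr; apply: eq_bigr => i _.
rewrite mulrA; congr (_ * _).
exact: pd_scale (nonzero_derivable i sf (val_neq0 x)).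
Qed.

Lemma gradprodC f g x : gradprod f g x = gradprod g f x.
Proof. by apply: eq_bigr => i _; rewrite mulrC. Qed.

(** The Laplacian in polar coordinates, on homogeneous functions. *)
Lemma lap_homogeneous G b x : smoothU nonzero G -> homogeneous b G ->
  lap (fun y => G (val y)) x = b * (b + n%:R - 1) * G (val x) - laplacian G (val x).
Proof.
move=> sG hG; rewrite lapE; last exact: smooth_homogeneous hG.
have x0 := val_neq0 x.
rewrite (@laplacian_ext _ _ _ (fun z => normpow (- b) z * G z))//; last first.
  by move=> y y0; rewrite (ray_ext_homogeneous hG).
rewrite laplacianM//; last exact: smoothU_normpow.
rewrite laplacian_normpow// (dotgrad_normpow _ sG hG)// !normpow_val -natr1.
by ring.
Qed.

(** The extension of [f] that is homogeneous of degree [b]. *)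
Definition homext b f z : R := normpow b z * ray_ext f z.

Lemma smooth_homext b f : Cinfty f -> smoothU nonzero (homext b f).
Proof.
by move=> /smoothE sf; exact: (smoothUM (@open_nonzero _ _) (@smoothU_normpow _ _ b)).
Qed.

Lemma homogeneous_homext b f : homogeneous b (homext b f).
Proof.
have := homogeneousM (@homogeneous_normpow R n.+1 b) (homogeneous_ray_ext f).
by rewrite addr0.
Qed.

Lemma homext_val b f x : homext b f (val x) = f x.
Proof. by rewrite /homext normpow_val mul1r ray_ext_val. Qed.

Definition eigenfunction lam f := Cinfty f /\ forall x, lap f x = lam * f x.

(** The partial derivatives of a homogeneous harmonic function are again
    homogeneous harmonic, of one degree less: differentiation is a lowering
    operator on eigenfunctions, with eigenvalues parametrized by the degree. *)
Definition lower b f i x : R := pd i (homext b f) (val x).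

(** By [lap_homogeneous], [b (b + n - 1)] is the eigenvalue for which the Laplacian
    of the extension vanishes on the sphere; homogeneity propagates this along
    rays. *)
Lemma laplacian_homext b f z : eigenfunction (b * (b + n%:R - 1)) f -> z != 0 ->
  laplacian (homext b f) z = 0.
Proof.
move=> [sf ef] z0; have sG := smooth_homext b sf.
have hG := homogeneous_homext b f.
have L0 x : laplacian (homext b f) (val x) = 0.
  have := lap_homogeneous x sG hG; rewrite (_ : (fun y => _) = f); last first.
    by apply/funext => y; exact: homext_val.
  rewrite ef homext_val => /eqP; rewrite -subr_eq0 opprB addrCA subrr addr0.
  by move=> /eqP.
have z1 := enorm_gt0 z0.
have -> : z = enorm z *: val (radial z).
  by rewrite val_radial// scalerA divff ?scale1r// gt_eqF.
by rewrite (homogeneous_laplacian sG hG)// ?L0 ?mulr0// val_neq0.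
Qed.

Lemma eigenfunction_lower b f i : eigenfunction (b * (b + n%:R - 1)) f ->
  eigenfunction ((b - 1) * (b - 1 + n%:R - 1)) (lower b f i).
Proof.
move=> ef; have [sf _] := ef; have sG := smooth_homext b sf.
have hG := homogeneous_pd i sG (homogeneous_homext b f).
split; first exact: smooth_homogeneous (smoothU_pd i sG) hG.
move=> x; rewrite (lap_homogeneous x (smoothU_pd i sG) hG).
rewrite pd_laplacian ?val_neq0//.
have -> : pd i (laplacian (homext b f)) (val x) = 0.
  rewrite -[RHS](pd_cst 0 (val x) i).
  apply: (pd_ext i (@open_nonzero _ _) (val_neq0 x)) => y y0.
  exact: laplacian_homext.
by rewrite subr0.
Qed.

(** Euler's identity recovers [f] from its lowerings. *)
Lemma lower_eq0 b f : b != 0 -> Cinfty f ->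
  (forall i x, lower b f i x = 0) -> forall x, f x = 0.
Proof.
move=> b0 sf L0 x; apply: (mulfI b0); rewrite mulr0 -(homext_val b f x).
rewrite -(euler (smooth_homext b sf) (homogeneous_homext b f) (val_neq0 x)).
by rewrite big1// => i _; rewrite -/(lower b f i x) L0 mulr0.
Qed.

End sphere_functions.

(** * Integration over R^d *)

Section tuple_measure.
Variable R : realType.
Local Notation mR := (measurableTypeR R).
Local Notation leb := (@lebesgue_measure R).

Definition boxset d (I : 'I_d -> set R) : set (d.-tuple mR) :=
  [set t | forall i, I i (tnth t i)].

Lemma measurable_boxset d (J : 'I_d -> set R) :
  (forall i, measurable (J i : set mR)) -> measurable (boxset J).
Proof.
move=> mI.
have -> : boxset J = \bigcap_(i in [set: 'I_d]) ((fun t : d.-tuple mR => tnth t i) @^-1` J i).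
  by apply/seteqP; split => [t H i _|t H i]; [exact: H|exact: (H i I)].
apply: fin_bigcap_measurable; first exact: finite_finset.
by move=> i _; rewrite -[X in measurable X]setTI; exact: measurable_tnth.
Qed.

Lemma tnth_tcons0 d (x : mR) (t : d.-tuple mR) : tnth (tcons (x, t)) ord0 = x.
Proof. by []. Qed.

Lemma tnth_tconsS d (x : mR) (t : d.-tuple mR) i :
  tnth (tcons (x, t)) (lift ord0 i) = tnth t i.
Proof. by rewrite /tcons tnthS. Qed.

Lemma lebesgue_tuple_boxsetS d (I : 'I_d.+1 -> set R) :
  (forall i, measurable (I i : set mR)) ->
  lebesgue_tuple R d.+1 (boxset I) =
  (leb (I ord0) * lebesgue_tuple R d (boxset (fun i => I (lift ord0 i))))%E.
Proof.
move=> mI; rewrite -product_measure1E//; last exact: measurable_boxset.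
rewrite /= /lebesgue_step /pushforward.
congr (product_measure1 _ _ _).
apply/seteqP; split => -[x t] /=.
  move=> H; split; first exact: (H ord0).
  by move=> i /=; have := H (lift ord0 i); rewrite tnth_tconsS.
move=> [Ix It] i; have [j ->|->] := unliftP ord0 i.
  by rewrite tnth_tconsS; exact: It.
exact: Ix.
Qed.

Lemma lebesgue_tuple_boxset_lty d (I : 'I_d -> set R) :
  (forall i, measurable (I i : set mR)) -> (forall i, (leb (I i) < +oo)%E) ->
  (lebesgue_tuple R d (boxset I) < +oo)%E.
Proof.
elim: d I => [|d IH] I mI fI.
  by rewrite /= (@le_lt_trans _ _ 1%E) ?ltry//= diracE lee_fin lern1 leq_b1.
rewrite lebesgue_tuple_boxsetS// lte_mul_pinfty//; last exact: IH.
by rewrite ge0_fin_numE.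
Qed.

Lemma lebesgue_tuple_boxset_gt0 d (I : 'I_d -> set R) :
  (forall i, measurable (I i : set mR)) -> (forall i, (0 < leb (I i))%E) ->
  (0 < lebesgue_tuple R d (boxset I))%E.
Proof.
elim: d I => [|d IH] I mI pI.
  by rewrite /= diracE mem_set ?lte_fin ?ltr01// => -[].
by rewrite lebesgue_tuple_boxsetS// mule_gt0//; exact: IH.
Qed.

Definition cube d (M : R) : set (d.-tuple mR) := boxset (fun=> `[- M, M]%classic).

Lemma measurable_cube d M : measurable (cube (d:=d) M).
Proof. by apply: measurable_boxset => i; exact: measurable_itv. Qed.

Lemma lebesgue_tuple_cube_lty d M : (lebesgue_tuple R d (cube M) < +oo)%E.
Proof.
apply: lebesgue_tuple_boxset_lty => i; first exact: measurable_itv.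
by rewrite lebesgue_measure_itv/=; case: ifP => _; rewrite ?ltry// -EFinB ltry.
Qed.

(** Bounded functions with bounded support: they are integrable, and remain in
    the class when some variables are frozen. *)
Definition bounded_support d (h : d.-tuple mR -> R) := exists M : R,
  (forall t, `|h t| <= M) /\ (forall t, h t != 0 -> cube M t).

Lemma integrable_restrict_support d (T : measurableType d)
    (mu : {measure set T -> \bar R}) (A : set T) (h : T -> R) (M : R) :
  measurable A -> (mu A < +oo)%E -> measurable_fun setT h ->
  (forall t, `|h t| <= M) -> (forall t, h t != 0 -> A t) ->
  mu.-integrable setT (EFin \o h).
Proof.
move=> mA fA mh hM hA.
have -> : EFin \o h = (EFin \o h) \_ A.
  apply/funext => t; rewrite /patch; case: ifPn => // tA.
  apply/eqP; rewrite eqe; apply/negP => /negP/hA At.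
  by move/negP: tA; apply; rewrite inE.
apply/(integrable_mkcond _ mA); apply: measurable_bounded_integrable => //.
  exact: measurable_funTS.
exists M; split; first exact: num_real.
by move=> y My t _ /=; rewrite (le_trans (hM t))// ltW.
Qed.

Lemma integrable_bounded_support d (h : d.-tuple mR -> R) :
  measurable_fun setT h -> bounded_support h ->
  (lebesgue_tuple R d).-integrable setT (EFin \o h).
Proof.
move=> mh [M [hM hs]].
exact: (integrable_restrict_support (@measurable_cube d M)
  (lebesgue_tuple_cube_lty _ _) mh hM hs).
Qed.

Definition tset d (t : d.-tuple mR) (i : 'I_d) (s : R) : d.-tuple mR :=
  [tuple if k == i then s else tnth t k | k < d].

(** Fubini's theorem, peeling off the first coordinate until it is the direction
    [i] of the lines. *)
Lemma integral_slices d (i : 'I_d) (h : d.-tuple mR -> R) :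
  measurable_fun setT h -> bounded_support h ->
  (forall t, \int[leb]_s (h (tset t i s))%:E = 0)%E ->
  (\int[lebesgue_tuple R d]_t (h t)%:E = 0)%E.
Proof.
elim: d i h => [[]//|d IH] i h mh bh h0.
have ih := integrable_bounded_support mh bh.
have mt := @measurable_tcons R d.
have mht : measurable_fun setT (h \o @tcons R d) by exact: measurableT_comp.
have [M [hM hs]] := bh.
have iht : (leb \x lebesgue_tuple R d)%E.-integrable setT (EFin \o (h \o @tcons R d)).
  apply: (@integrable_restrict_support _ _ _ (@tcons R d @^-1` cube M) _ M) => //.
  - by rewrite -[X in measurable X]setTI; exact: mt (measurable_cube M).
  - exact: (@lebesgue_tuple_cube_lty d.+1 M).
  - by move=> t; exact: hM.
  - by move=> t; exact: hs.
have E1 : (\int[lebesgue_tuple R d.+1]_t (h t)%:E =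
    \int[(leb \x lebesgue_tuple R d)%E]_p (h (tcons p))%:E)%E.
  transitivity (\int[pushforward (leb \x lebesgue_tuple R d)%E (@tcons R d)]_t (h t)%:E)%E.
    by [].
  by rewrite integral_pushforward//=; exact/measurable_EFinP.
rewrite E1; have [i0|[j ij]] : i = ord0 \/ exists j, i = lift ord0 j.
  by case: (unliftP ord0 i) => [j ->|->]; [right; exists j|left].
- rewrite -(integral21_prod_meas1 iht) integral0_eq// => t _.
  rewrite /fubini_G/= -[RHS](h0 (tcons (0, t))); apply: eq_integral => s _.
  congr (h _)%:E; apply: eq_from_tnth => k; rewrite tnth_mktuple i0.
  by have [l ->|->] := unliftP ord0 k; rewrite ?tnth_tconsS ?tnth_tcons0.
- rewrite -(integral12_prod_meas1 iht) integral0_eq// => x _.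
  rewrite /fubini_F/=; apply: (IH j (fun t => h (tcons (x, t)))).
  + apply: (@measurableT_comp _ _ _ _ _ _ h _ (fun t => tcons (x, t))) => //.
    exact: (@measurable_cons _ _ _ _ (cst x) d id).
  + exists M; split=> t; first exact: hM.
    by move=> /hs H k; have := H (lift ord0 k); rewrite tnth_tconsS.
  + move=> t; rewrite -[RHS](h0 (tcons (x, t))); apply: eq_integral => s _.
    congr (h _)%:E; apply: eq_from_tnth => k; rewrite tnth_mktuple ij.
    have [l ->|->] := unliftP ord0 k; last by rewrite ?tnth_tcons0.
    by rewrite !tnth_tconsS tnth_mktuple (inj_eq lift_inj).
Qed.

Definition rowt d (t : d.-tuple mR) : 'rV[R]_d := \row_i tnth t i.

(** [F] is the pointwise limit of its values at the lower corners of the cells of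
    a grid of mesh [1 / k.+1], and there are countably many cells. *)
Lemma measurable_continuous d (F : 'rV[R]_d -> R) : continuous F ->
  measurable_fun setT (F \o @rowt d).
Proof.
move=> cF.
pose q (k : nat) (t : d.-tuple mR) : d.-tuple int :=
  [tuple Num.floor (k.+1%:R * tnth t i) | i < d].
pose c (k : nat) (u : d.-tuple int) : 'rV[R]_d := \row_i ((tnth u i)%:~R / k.+1%:R).
have mq k u : measurable (q k @^-1` [set u]).
  have -> : q k @^-1` [set u] = boxset (fun i : 'I_d =>
      `[(tnth u i)%:~R / k.+1%:R, (tnth u i + 1)%:~R / k.+1%:R[%classic).
    have k0 : (0 : R) < k.+1%:R by [].
    apply/seteqP; split => t /=.
      move=> <- i /=; rewrite in_itv/= ler_pdivrMr// ltr_pdivlMr//.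
      by rewrite tnth_mktuple ![tnth t i * _]mulrC; exact: floor_itv.
    move=> H; apply: eq_from_tnth => i; rewrite tnth_mktuple.
    apply: floor_def; have := H i; rewrite /= in_itv/= ler_pdivrMr// ltr_pdivlMr//.
    by rewrite ![tnth t i * _]mulrC.
  by apply: measurable_boxset => i; exact: measurable_itv.
apply: (@measurable_fun_cvg _ _ _ _ (fun k t => F (c k (q k t)))) => [k|t _].
  move=> _ Y mY; rewrite setTI.
  have -> : (fun t => F (c k (q k t))) @^-1` Y =
      \bigcup_(u : d.-tuple int) (if `[< Y (F (c k u)) >] then q k @^-1` [set u] else set0).
    apply/seteqP; split => t /=.
      by move=> Yt; exists (q k t) => //; rewrite asboolT.
    by move=> [u _]; case: asboolP => // Yu /= ->.
  apply: countable_bigcupT_measurable; first exact: countableP.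
  by move=> u; case: asboolP.
apply: (@cvg_comp _ _ _ (fun k => c k (q k t)) F _ (nbhs (rowt t))); last exact: cF.
apply/cvgrPdist_le => e e0; near=> k.
rewrite /Num.Def.normr /= mx_normrE; apply: bigmax_le; first exact: ltW.
move=> [a i] _ /=; rewrite !mxE tnth_mktuple {a}.
have k0 : (0 : R) < k.+1%:R by [].
have /andP[f1 f2] := floor_itv (k.+1%:R * tnth t i).
rewrite intrD in f2.
have -> : tnth t i - (Num.floor (k.+1%:R * tnth t i))%:~R / k.+1%:R =
  (k.+1%:R * tnth t i - (Num.floor (k.+1%:R * tnth t i))%:~R) / k.+1%:R.
  by rewrite mulrBl mulrAC divff ?mul1r// gt_eqF.
rewrite ger0_norm; last by rewrite divr_ge0// subr_ge0.
rewrite ler_pdivrMr//.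
have ke : e^-1 <= k.+1%:R.
  near: k; exists (Num.truncn e^-1) => //= k /= ek.
  by rewrite ltW// (lt_le_trans (truncnS_gt _))// ler_nat.
have : 1 <= e * k.+1%:R by rewrite -ler_pdivrMl// mulr1.
by lra.
Unshelve. all: by end_near. Qed.

End tuple_measure.

(** * Cutoff functions *)

Section cutoff.
Variable R : realType.
Implicit Types (e s : R).

Definition sqpos s : R := Num.max s 0 ^+ 2.

Lemma continuous_pos : continuous (fun s : R => Num.max s 0).
Proof.
by move=> s; apply: (@continuous_max _ _ id (cst 0)) => //; exact: cst_continuous.
Qed.

Lemma is_derive_sqpos s : is_derive s (1 : R) sqpos (2 * Num.max s 0).
Proof.
have [s0|s0|->] := ltgtP s 0.
- rewrite mulr0; apply: (@near_eq_is_derive _ _ _ (cst 0)).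
    near=> t; rewrite /sqpos max_r ?expr0n//=.
    by apply/ltW; near: t; exact: lt_nbhsl.
- apply: (@near_eq_is_derive _ _ _ (fun t : R => t ^+ 2)).
    near=> t; rewrite /sqpos max_l//.
    by apply/ltW; near: t; exact: lt_nbhsr.
  have := @is_deriveX _ _ (@id R) 2 s 1 _ (is_derive_id _ _).
  by rewrite /= expr1 /GRing.scale /= mulr1.
- rewrite mulr0; apply/is_deriveE; apply/cvgr0Pnorm_le => e e0; near=> h.
  rewrite [_%:A]mulr1 addr0 /sqpos maxxx [X in _ - X]expr0n/= subr0.
  have h0 : h != 0 by near: h; exact: nbhs_dnbhs_neq.
  have he : `|h| <= e by near: h; exact: dnbhs0_le.
  rewrite (le_trans _ he)// normrM normfV ler_pdivrMl ?normr_gt0// -expr2 normrX.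
  rewrite lerXn2r ?nnegrE// -[X in _ <= X]ger0_norm//.
  by case: (leP h 0) => h00; rewrite ?normr0 ?normr_id.
Unshelve. all: by end_near. Qed.

(** As [e] tends to [0], a C^1 approximation of the indicator function of the
    positive reals. *)
Definition ramp e s : R := 1 - e * (sqpos s + e)^-1.
Definition dramp e s : R := e * ((sqpos s + e) ^- 2 * (2 * Num.max s 0)).

Lemma sqpos_ge0 s : 0 <= sqpos s. Proof. exact: sqr_ge0. Qed.

Lemma ramp_den_gt0 e s : 0 < e -> 0 < sqpos s + e.
Proof. by move=> e0; rewrite ltr_wpDl// sqpos_ge0. Qed.

Lemma is_derive_ramp e s : 0 < e -> is_derive s (1 : R) (ramp e) (dramp e s).
Proof.
move=> e0; have d0 := ramp_den_gt0 s e0.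
have D1 : is_derive s (1 : R) (fun t => sqpos t + e) (2 * Num.max s 0 + 0).
  exact: (is_deriveD (is_derive_sqpos s) (is_derive_cst _ _ _)).
have D2 := @is_deriveV _ (fun t => sqpos t + e) s _ 1 (lt0r_neq0 d0) D1.
have D3 := is_deriveZ e D2.
have := is_deriveB (is_derive_cst (1 : R) s 1) D3.
rewrite addr0 /dramp sub0r /GRing.scale /= mulNr mulrN opprK; exact.
Qed.

Lemma continuous_ramp e : 0 < e -> continuous (ramp e).
Proof.
move=> e0 s; have [dr _] := is_derive_ramp s e0.
exact/differentiable_continuous/derivable1_diffP.
Qed.

Lemma continuous_dramp e : 0 < e -> continuous (dramp e).
Proof.
move=> e0 s.
have cs : {for s, continuous (fun t => sqpos t + e)}.
  apply: (@continuousD R R R sqpos (cst e)); last exact: cst_continuous.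
  have [dr _] := is_derive_sqpos s.
  exact/differentiable_continuous/derivable1_diffP.
apply: (@continuousM R R (cst e) (fun t => (sqpos t + e) ^- 2 * (2 * Num.max t 0))).
  exact: cst_continuous.
apply: (@continuousM R R (fun t => (sqpos t + e) ^- 2) (fun t => 2 * Num.max t 0)).
  apply: (@continuousV R R (fun t => (sqpos t + e) ^+ 2)).
    by rewrite expf_eq0/= gt_eqF ?ramp_den_gt0.
  exact: (continuousM cs cs).
by apply: (@continuousM R R (cst 2)); [exact: cst_continuous|exact: continuous_pos].
Qed.

Lemma ramp_itv e s : 0 < e -> 0 <= ramp e s <= 1.
Proof.
move=> e0; have d0 := ramp_den_gt0 s e0.
rewrite /ramp subr_ge0 lerBlDr lerDl.
rewrite ler_pdivrMr// mul1r lerDr sqpos_ge0/=.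
by rewrite mulr_ge0// ?invr_ge0 ltW.
Qed.

Lemma ramp_eq0 e s : 0 < e -> s <= 0 -> ramp e s = 0.
Proof.
move=> e0 s0; rewrite /ramp /sqpos max_r// expr0n/= add0r divff ?subrr//.
by rewrite gt_eqF.
Qed.

Lemma dramp_eq0 e s : s <= 0 -> dramp e s = 0.
Proof. by move=> s0; rewrite /dramp max_r// !mulr0. Qed.

Lemma ramp_ge e s : 0 < e -> 0 < s -> 1 - e / s ^+ 2 <= ramp e s.
Proof.
move=> e0 s0; rewrite /ramp lerB// ler_wpM2l ?(ltW e0)//.
rewrite lef_pV2 ?posrE ?ramp_den_gt0// ?exprn_gt0//.
by rewrite /sqpos max_l ?(ltW s0)// lerDl ltW.
Qed.

(** A C^1 approximation of the indicator function of the interval (0, 1],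
    supported in [del, 1 + del]. With the exponent [3] the right factor is still at
    least [1 - del] at [s = 1], so that the right end is included in the limit. *)
Definition plateau (del s : R) : R := ramp (del ^+ 3) (s - del) * ramp (del ^+ 3) (1 + del - s).
Definition dplateau (del s : R) : R :=
  dramp (del ^+ 3) (s - del) * ramp (del ^+ 3) (1 + del - s)
  - ramp (del ^+ 3) (s - del) * dramp (del ^+ 3) (1 + del - s).

Section fixed_del.
Variable del : R.
Hypothesis del0 : 0 < del.
Let e0 : 0 < del ^+ 3. Proof. exact: exprn_gt0. Qed.

Lemma is_derive_plateau s : is_derive s (1 : R) (plateau del) (dplateau del s).
Proof.
have D1 : is_derive s (1 : R) (fun t => ramp (del ^+ 3) (t - del)) (dramp (del ^+ 3) (s - del)).
  have := @is_derive1_comp _ (ramp (del ^+ 3)) (shift (- del)) s _ _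
    (is_derive_ramp _ e0) (is_derive_shift s 1 _).
  by rewrite mulr1.
have D2 : is_derive s (1 : R) (fun t => ramp (del ^+ 3) (1 + del - t)) (- dramp (del ^+ 3) (1 + del - s)).
  have D3 : is_derive s (1 : R) (fun t => 1 + del - t) (0 - 1).
    exact: (is_deriveB (is_derive_cst _ _ _) (is_derive_id _ _)).
  have := @is_derive1_comp _ (ramp (del ^+ 3)) (fun t => 1 + del - t) s _ _
    (is_derive_ramp _ e0) D3.
  by rewrite sub0r mulrN1.
rewrite (_ : dplateau del s = ramp (del ^+ 3) (s - del) *: (- dramp (del ^+ 3) (1 + del - s))
  + ramp (del ^+ 3) (1 + del - s) *: dramp (del ^+ 3) (s - del)).
  exact: is_deriveM D1 D2.
by rewrite /dplateau /GRing.scale /=; ring.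
Qed.

Lemma continuous_plateau : continuous (plateau del).
Proof.
move=> s; have [dr _] := is_derive_plateau s.
exact/differentiable_continuous/derivable1_diffP.
Qed.

Lemma continuous_dplateau : continuous (dplateau del).
Proof.
have c1 (phi : R -> R) : continuous phi -> continuous (fun t => phi (t - del)).
  move=> cphi s; apply: (@continuous_comp _ _ _ (shift (- del)) phi); last exact: cphi.
  by apply: (@continuousD _ _ _ id (cst (- del))); [exact: cvg_id|exact: cst_continuous].
have c2 (phi : R -> R) : continuous phi -> continuous (fun t => phi (1 + del - t)).
  move=> cphi s; apply: (@continuous_comp _ _ _ (fun t => 1 + del - t) phi); last exact: cphi.
  by apply: (@continuousB _ _ _ (cst (1 + del)) id); [exact: cst_continuous|exact: cvg_id].
move=> s; apply: (@continuousB R R R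
  (fun t => dramp (del ^+ 3) (t - del) * ramp (del ^+ 3) (1 + del - t))
  (fun t => ramp (del ^+ 3) (t - del) * dramp (del ^+ 3) (1 + del - t)));
  apply: (@continuousM R R).
- exact: (c1 _ (continuous_dramp e0)).
- exact: (c2 _ (continuous_ramp e0)).
- exact: (c1 _ (continuous_ramp e0)).
- exact: (c2 _ (continuous_dramp e0)).
Qed.

Lemma plateau_eq0 s : s <= del \/ 1 + del <= s -> plateau del s = 0.
Proof.
case=> h; rewrite /plateau.
  by rewrite (@ramp_eq0 _ (s - del) e0) ?mul0r// subr_le0.
by rewrite (@ramp_eq0 _ (1 + del - s) e0) ?mulr0// subr_le0.
Qed.

Lemma dplateau_eq0 s : s <= del \/ 1 + del <= s -> dplateau del s = 0.
Proof.
case=> h; rewrite /dplateau.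
  have h' : s - del <= 0 by rewrite subr_le0.
  by rewrite (dramp_eq0 _ h') (ramp_eq0 e0 h') !mul0r subrr.
have h' : 1 + del - s <= 0 by rewrite subr_le0.
by rewrite (dramp_eq0 _ h') (ramp_eq0 e0 h') !mulr0 subrr.
Qed.

Lemma plateau_itv s : 0 <= plateau del s <= 1.
Proof.
have /andP[a0 a1] := ramp_itv (s - del) e0.
have /andP[b0 b1] := ramp_itv (1 + del - s) e0.
by rewrite mulr_ge0//= mulr_ile1.
Qed.

Lemma plateau_ge s : del <= 1 -> 0 < s <= 1 -> del < s / 2 ->
  1 - del * (1 + 4 / s ^+ 2) <= plateau del s.
Proof.
move=> del1 /andP[s0 s1] ds.
have h1 : 1 - 4 * del / s ^+ 2 <= ramp (del ^+ 3) (s - del).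
  apply: le_trans (ramp_ge e0 _); last by lra.
  rewrite lerB// ler_pdivrMr; last by rewrite exprn_gt0//; lra.
  rewrite mulrAC ler_pdivlMr ?exprn_gt0//.
  have : s ^+ 2 <= 4 * (s - del) ^+ 2.
    rewrite -ler_pdivrMl// mulrC.
    rewrite (_ : s ^+ 2 / 4 = (s / 2) ^+ 2); last by field.
    by rewrite lerXn2r ?nnegrE; lra.
  have : del ^+ 3 <= del.
    by rewrite exprS -[leRHS]mulr1 ler_wpM2l ?(ltW del0)// exprn_ile1// ltW.
  have := exprn_gt0 2 s0; have D0 := ltW e0.
  move: (s ^+ 2) ((s - del) ^+ 2) (del ^+ 3) D0 => S T D D0 S0 hD hS.
  rewrite (le_trans (ler_wpM2l D0 hS))// mulrA [4 * del]mulrC ler_wpM2r//; last by rewrite ler_wpM2r.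
  by have := ltW S0; lra.
have h2 : 1 - del <= ramp (del ^+ 3) (1 + del - s).
  have u0 : del <= 1 + del - s by rewrite lerBrDr addrC lerD2r.
  have u1 := lt_le_trans del0 u0.
  apply: le_trans (ramp_ge e0 u1).
  rewrite lerB// ler_pdivrMr ?exprn_gt0//.
  by rewrite exprS ler_wpM2l ?(ltW del0)// lerXn2r ?nnegrE ?(ltW del0) ?(ltW u1).
have /andP[a0 a1] := ramp_itv (s - del) e0.
have /andP[b0 b1] := ramp_itv (1 + del - s) e0.
have hx : 4 * del / s ^+ 2 = del * (4 / s ^+ 2) by ring.
rewrite hx in h1; rewrite /plateau.
move: (ramp _ _) (ramp _ _) (4 / s ^+ 2) h1 h2 a0 a1 b0 b1 => p q r h1 h2 a0 a1 b0 b1.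
have : p * q >= p + q - 1 by nra.
by lra.
Qed.

End fixed_del.

(** At most [1 / 2], so that all the plateaus vanish from [2] on. *)
Definition width (k : nat) : R := k.+2%:R^-1.

Lemma width_gt0 k : 0 < width k. Proof. by rewrite invr_gt0. Qed.

Lemma width_le k : width k <= 2^-1.
Proof. by rewrite lef_pV2 ?posrE// ler_nat. Qed.

Lemma cvg_width : width k @[k --> \oo] --> 0.
Proof.
have := @cvg_harmonic R; rewrite -(cvg_shiftS); apply: cvg_trans.
by apply: near_eq_cvg; near=> k.
Unshelve. all: by end_near. Qed.

Lemma cvg_plateau s : plateau (width k) s @[k --> \oo] --> (if 0 < s <= 1 then 1 else 0 : R).
Proof.
have near_lt (c : R) : 0 < c -> \forall k \near \oo, width k < c.
  move=> c0; have /cvgrPdist_lt/(_ c c0) := cvg_width.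
  by apply: filterS => k; rewrite sub0r normrN gtr0_norm ?width_gt0.
case: ifPn => [/andP[s0 s1]|].
  apply: (@squeeze_cvgr _ _ _ _ (fun k => 1 - width k * (1 + 4 / s ^+ 2)) (cst 1)).
  - near=> k; have /andP[_ ->] := plateau_itv (width_gt0 k) s; rewrite andbT.
    apply: plateau_ge; rewrite ?width_gt0 ?s0//.
      by rewrite (le_trans (width_le k))// invf_le1// ler1n.
    by near: k; apply: near_lt; rewrite divr_gt0.
  - rewrite -[X in _ --> X]subr0 -[X in _ - X](mul0r (1 + 4 / s ^+ 2)).
    by apply: cvgB; [exact: cvg_cst|apply: cvgM; [exact: cvg_width|exact: cvg_cst]].
  - exact: cvg_cst.
rewrite negb_and -leNgt -ltNge => /orP[s0|s1]; apply: cvg_near_cst; near=> k.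
  apply: plateau_eq0; first exact: width_gt0.
  by left; rewrite (le_trans s0)// ltW// width_gt0.
apply: plateau_eq0; first exact: width_gt0.
right; rewrite -lerBrDl; apply: ltW; near: k; apply: near_lt.
by rewrite subr_gt0.
Unshelve. all: by end_near. Qed.

End cutoff.

(** * Green's identity and the spectrum of the Laplacian *)

Section cut_fields.
Variables (R : realType) (d : nat).
Local Notation E := 'rV[R]_d.
Local Notation mR := (measurableTypeR R).
Local Notation leb := (@lebesgue_measure R).
Local Notation e_ i := (delta_mx ord0 i : E).
Implicit Types (z : E) (F H : E -> R) (i : 'I_d).

Lemma continuous_sqnorm : continuous (@sqnorm R d).
Proof.
by move=> z; apply: (smoothU_continuous (smoothU_sqnorm (@openT E))).
Qed.

Lemma sqr_coord_le z i : z ord0 i ^+ 2 <= sqnorm z.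
Proof.
by rewrite /sqnorm (bigD1 i)//= lerDl sumr_ge0// => j _; exact: sqr_ge0.
Qed.

Lemma sqnorm0 : sqnorm (0 : E) = 0.
Proof. by apply/eqP; rewrite sqnorm_eq0. Qed.

Lemma near0_sqnorm (del : R) : 0 < del -> \forall z \near (0 : E), sqnorm z < del.
Proof.
move=> del0; have := @continuous_sqnorm (0 : E).
move=> /cvgrPdist_lt/(_ del del0); apply: filterS => z.
by rewrite sqnorm0 sub0r normrN ger0_norm// sqnorm_ge0.
Qed.

(** A cutoff vanishing near [0] removes the singularity of [H] at the origin. *)
Lemma continuous_cutM (phi : R -> R) (del : R) H : 0 < del -> continuous phi ->
  (forall s, s <= del -> phi s = 0) ->
  (forall z, z != 0 -> {for z, continuous H}) ->
  continuous (fun z => phi (sqnorm z) * H z).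
Proof.
move=> del0 cphi phi0 cH z; have [->|z0] := eqVneq z 0.
  have near0 : {near (0 : E), cst 0 =1 (fun z => phi (sqnorm z) * H z)}.
    apply: filterS (near0_sqnorm del0) => y /ltW/phi0 -> /=.
    by rewrite mul0r.
  have c0 : phi (sqnorm z) * H z @[z --> (0 : E)] --> (0 : R).
    by apply: (cvg_trans (near_eq_cvg near0)); exact: cvg_cst.
  have v0 : phi (sqnorm (0 : E)) * H 0 = 0 by rewrite sqnorm0 phi0 ?mul0r// ltW.
  by rewrite -v0 in c0.
apply: (@continuousM R E (phi \o @sqnorm R d) H); last exact: cH.
by apply: continuous_comp; [exact: continuous_sqnorm|exact: cphi].
Qed.

Lemma compact_sqnorm_le (r : R) : compact [set z : E | sqnorm z <= r].
Proof.
apply: bounded_closed_compact.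
  exists (Num.sqrt `|r|); split; first exact: num_real.
  move=> M rM z /= zr; rewrite /Num.Def.normr /= mx_normrE.
  apply: bigmax_le; first by rewrite (le_trans (sqrtr_ge0 `|r|))// ltW.
  move=> [a i] _ /=; rewrite (ord1 a) (le_trans _ (ltW rM))// -sqrtr_sqr.
  apply: ler_wsqrtr; rewrite (le_trans (sqr_coord_le z i))// (le_trans zr)//.
  exact: ler_norm.
apply: (@closed_comp _ _ (@sqnorm R d) [set s | s <= r]); last exact: closed_le.
by move=> z _; exact: continuous_sqnorm.
Qed.

Lemma bounded_cut F : continuous F -> (forall z, 2 <= sqnorm z -> F z = 0) ->
  exists C : R, forall z, `|F z| <= C.
Proof.
move=> cF F0; pose A := [set z : E | sqnorm z <= 2].
have A0 : A !=set0.
  by exists 0; rewrite /A /= sqnorm0.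
have cn : {within A, continuous (fun z => `|F z|)}.
  apply: continuous_subspaceT => z; apply: continuous_comp; first exact: cF.
  exact: norm_continuous.
have [c _ Hc] := compact_EVT_max A0 (@compact_sqnorm_le 2) cn.
exists `|F c| => z; have [z2|z2] := leP (sqnorm z) 2.
  by apply: Hc; rewrite inE.
by rewrite F0 ?normr0// ltW.
Qed.

Lemma bounded_support_cut F : continuous F -> (forall z, 2 <= sqnorm z -> F z = 0) ->
  bounded_support (F \o @rowt R d).
Proof.
move=> cF F0; have [C HC] := bounded_cut cF F0.
exists (Num.max C 2); split=> t /=; first by rewrite le_max HC.
move=> Ft i /=; rewrite in_itv/= -ler_norml le_max; apply/orP; right.
have s2 : sqnorm (rowt t) < 2 by rewrite ltNge; apply: contraNN Ft => /F0 ->.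
have := le_lt_trans (sqr_coord_le (rowt t) i) s2; rewrite mxE => t2.
rewrite -(@ler_pXn2r _ 2)// ?nnegrE// real_normK ?num_real//.
by rewrite (le_trans (ltW t2))//; lra.
Qed.

Lemma rowt_tset (t : d.-tuple mR) i (s : R) :
  rowt (tset t i s) = s *: e_ i + rowt (tset t i 0).
Proof.
apply/rowP => j; rewrite !mxE !tnth_mktuple eqxx/= [j == i]eq_sym.
by case: eqP => _; rewrite ?mulr1 ?addr0 ?mulr0 ?add0r.
Qed.

Section one_direction.
Variables (psi dpsi : R -> R) (del : R) (H : E -> R) (i : 'I_d).
Hypothesis del0 : 0 < del.
Hypothesis D : forall s : R, is_derive s (1 : R) psi (dpsi s).
Hypothesis cdpsi : continuous dpsi.
Hypothesis psi0 : forall s, s <= del \/ 2 <= s -> psi s = 0.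
Hypothesis dpsi0 : forall s, s <= del \/ 2 <= s -> dpsi s = 0.
Hypothesis sH : smoothU (@nonzero R d) H.

(** The component in the direction [i] of a field with compact support away from
    the origin, and its derivative in that direction. *)
Definition cutfield z : R := psi (sqnorm z) * H z.
Definition dcutfield z : R :=
  dpsi (sqnorm z) * (2 * z ord0 i * H z) + psi (sqnorm z) * pd i H z.

Let cpsi : continuous psi.
Proof.
by move=> s; have [dr _] := D s; exact/differentiable_continuous/derivable1_diffP.
Qed.

Let cH z : z != 0 -> {for z, continuous H}.
Proof. by move=> z0; exact: nonzero_continuous. Qed.

Lemma continuous_dcutfield : continuous dcutfield.
Proof.
move=> z; apply: (@continuousD R R E (fun z => dpsi (sqnorm z) * (2 * z ord0 i * H z))
  (fun z => psi (sqnorm z) * pd i H z)).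
  apply: continuous_cutM del0 _ _ _ z => // [s sd|z z0]; first by apply: dpsi0; left.
  apply: (@continuousM R E (fun z => 2 * z ord0 i) H); last exact: cH.
  apply: (@continuousM R E (cst 2) (fun z => z ord0 i)).
    exact: cst_continuous.
  exact: coord_continuous.
apply: continuous_cutM del0 _ _ _ z => // [s sd|z z0]; first by apply: psi0; left.
by apply: nonzero_continuous => //; exact: smoothU_pd.
Qed.

Lemma has_pd_cutfield z : has_pd i cutfield z (dcutfield z).
Proof.
have [->|z0] := eqVneq z 0.
  have -> : dcutfield 0 = 0.
    by rewrite /dcutfield sqnorm0 psi0 ?dpsi0 ?mul0r ?addr0//; left; exact: ltW.
  rewrite has_pdE; apply: (@near_eq_is_derive _ _ _ (cst 0)).
    apply: filterS (near0_sqnorm del0) => y /ltW yd /=.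
    by rewrite /cutfield psi0 ?mul0r//; left.
have D1 := has_pd_comp (D (sqnorm z)) (has_pd_sqnorm z i).
have dH := nonzero_derivable i sH z0.
have dpsi1 := has_pd_derivable D1.
have := pderivableP (pderivableM dpsi1 dH).
rewrite (pdM dpsi1 dH) (has_pd_val D1) /=.
by rewrite (_ : _ + _ = dcutfield z)// /dcutfield; ring.
Qed.

Lemma dcutfield0 z : 2 <= sqnorm z -> dcutfield z = 0.
Proof. by move=> z2; rewrite /dcutfield psi0 ?dpsi0 ?mul0r ?addr0//; right. Qed.

Lemma bounded_support_dcutfield : bounded_support (dcutfield \o @rowt R d).
Proof. exact: bounded_support_cut continuous_dcutfield dcutfield0. Qed.

(** On each line the integral of a derivative with compact support vanishes. *)
Lemma integral_dcutfield :
  (\int[lebesgue_tuple R d]_t (dcutfield (rowt t))%:E = 0)%E.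
Proof.
have mW := measurable_continuous continuous_dcutfield.
apply: (integral_slices (i := i) mW bounded_support_dcutfield) => t.
pose b := rowt (tset t i 0).
pose g (s : R) : R := dcutfield (s *: e_ i + b).
pose G (s : R) : R := cutfield (s *: e_ i + b).
have dG (s : R) : is_derive s (1 : R) G (g s).
  by apply: is_derive_line_at; rewrite -has_pdE; exact: has_pd_cutfield.
have cG : continuous G.
  by move=> s; have [dr _] := dG s; exact/differentiable_continuous/derivable1_diffP.
have cg : continuous g.
  move=> s; apply: (@continuous_comp _ _ _ (fun s : R => s *: e_ i + b) dcutfield).
    apply: (@continuousD R E R (fun s => s *: e_ i) (cst b)); last exact: cst_continuous.
    exact: scalel_continuous.
  exact: continuous_dcutfield.
have far (s : R) : 2 <= `|s| -> 2 <= sqnorm (s *: e_ i + b).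
  move=> s2; apply: le_trans (sqr_coord_le _ i).
  rewrite !mxE !tnth_mktuple !eqxx mulr1 addr0.
  rewrite -real_normK ?num_real// expr2.
  by move: s2; move: `|s| => a a2; nra.
pose I : set R := `[-2, 2]%classic.
transitivity (\int[leb]_(s in I) (g s)%:E)%E.
  rewrite [RHS]integral_mkcond; apply: eq_integral => s _.
  rewrite /= rowt_tset -/b -/(g s) /patch; case: ifPn => // /negP sN.
  congr (_%:E); apply: dcutfield0; apply: far.
  rewrite leNgt; apply/negP => s2; apply: sN; rewrite inE /I /= in_itv/=.
  by rewrite -ler_norml ltW.
rewrite (@continuous_FTC2 _ g G).
- have far2 : G 2 = 0.
    by rewrite /G /cutfield psi0 ?mul0r//; right; apply: far; rewrite ger0_norm.
  have farN2 : G (-2) = 0.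
    by rewrite /G /cutfield psi0 ?mul0r//; right; apply: far; rewrite normrN ger0_norm.
  by rewrite far2 farN2 sube0.
- by lra.
- exact: continuous_subspaceT.
- split=> [s _||]; first by case: (dG s).
  + exact: cvg_at_right_filter (cG _).
  + exact: cvg_at_left_filter (cG _).
- by move=> s _; rewrite derive1E; case: (dG s).
Qed.

End one_direction.

End cut_fields.

Lemma ge0_integral_mscale_mrestr (R : realType) (disp : measure_display)
    (T : measurableType disp) (m : {measure set T -> \bar R}) (B : set T)
    (mB : measurable B) (k : {nonneg R}) (h : T -> \bar R) :
  measurable_fun setT h -> (forall t, 0 <= h t)%E ->
  (\int[mscale k (mrestr m mB)]_t h t = k%:num%:E * \int[m]_(t in B) h t)%E.
Proof.
move=> mh h0; rewrite ge0_integral_mscale//; congr (_ * _)%E.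
rewrite (@ge0_negligible_integral _ _ _ _ setT (~` B))//; last 2 first.
- exact: measurableC.
- by transitivity (m (~` B `&` B)); rewrite // setICl measure0.
rewrite setTD setCK; apply: eq_measure_integral => A mA AB.
by rewrite /mrestr; congr (m _); exact/setIidPl.
Qed.

Lemma integral_mscale_mrestr (R : realType) (disp : measure_display)
    (T : measurableType disp) (m : {measure set T -> \bar R}) (B : set T)
    (mB : measurable B) (k : {nonneg R}) (h : T -> \bar R) :
  measurable_fun setT h -> m.-integrable B h ->
  (\int[mscale k (mrestr m mB)]_t h t = k%:num%:E * \int[m]_(t in B) h t)%E.
Proof.
move=> mh ih; rewrite [LHS]integralE [X in (_ * X)%E]integralE.
have mp := measurable_funepos mh; have mn := measurable_funeneg mh.
rewrite (ge0_integral_mscale_mrestr m mB k mp)// (ge0_integral_mscale_mrestr m mB k mn)//.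
apply/esym; apply: muleBr => //; apply: fin_num_adde_defl.
by rewrite fin_numN; exact: integrable_neg_fin_num.
Qed.

Section sphere_measure.
Variables (R : realType) (n : nat).
Local Notation E := 'rV[R]_n.+1.
Local Notation S := (sphere R n).
Local Notation mR := (measurableTypeR R).
Local Notation lam := (lebesgue_tuple R n.+1).
Local Notation B := (@punctured_ball R n).
Local Notation mu := (@mu0 R n).
Implicit Types (f g : S -> R) (x : S) (z : E).

(** The radial extension of [f] times a cutoff: through it, measurability and
    boundedness on the sphere reduce to continuity on the whole space. *)
Lemma Cinfty_bump f : Cinfty f -> exists V : E -> R, [/\ continuous V,
  (forall z, 2 <= sqnorm z -> V z = 0) & (forall x, V (val x) = f x)].
Proof.
(* The width only has to be small enough for [plateau_ge] at [s = 1]. *)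
move=> /smoothE sf; pose del : R := 10^-1.
have del0 : 0 < del by rewrite invr_gt0.
have c1 : 0 < plateau del 1.
  have h := @plateau_ge _ del del0 1; apply: (lt_le_trans _ (h _ _ _)).
  - by rewrite expr1n /del; lra.
  - by rewrite /del; lra.
  - by rewrite ltr01 lexx.
  - by rewrite /del; lra.
exists (fun z => plateau del (sqnorm z) * ((plateau del 1)^-1 * ray_ext f z)); split.
- apply: (continuous_cutM del0); first exact: continuous_plateau.
    by move=> s sd; apply: plateau_eq0 => //; left.
  move=> z z0; apply: (@continuousM R E (cst (plateau del 1)^-1) (ray_ext f)).
    exact: cst_continuous.
  exact: nonzero_continuous.
- move=> z z2; rewrite plateau_eq0 ?mul0r//; right; apply: le_trans z2.
  by rewrite /del; lra.
- move=> x; rewrite -enorm_sqr enorm_val expr1n ray_ext_val mulrA divff ?mul1r//.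
  by rewrite gt_eqF.
Qed.

Lemma Cinfty_bounded f : Cinfty f -> exists C : R, forall x, `|f x| <= C.
Proof.
move=> /Cinfty_bump [V [cV V0 Vf]]; have [C HC] := bounded_cut cV V0.
by exists C => x; rewrite -Vf.
Qed.

Lemma measurable_Cinfty f : Cinfty f -> measurable_fun setT (f : S -> mR).
Proof.
move=> /Cinfty_bump [V [cV V0 Vf]].
have -> : f = (V \o @rowt R n.+1) \o @sphere_coord R n.
  apply/funext => x /=; rewrite -Vf; congr V; apply/rowP => i.
  by rewrite mxE tnth_mktuple.
apply: measurableT_comp; first exact: measurable_continuous.
by move=> _ Y mY; exists Y.
Qed.

Definition ball_measure := mscale (n.+1%:R%:nng : {nonneg R})
  (mrestr lam (@measurable_punctured_ball R n)).

Lemma punctured_ball_cube : B `<=` cube 1.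
Proof.
move=> t /andP[_ t1] i /=; rewrite in_itv/= -ler_norml.
rewrite -(@ler_pXn2r _ 2)// ?nnegrE// real_normK ?num_real// expr1n.
have := sqr_coord_le (row_of_tuple t) i; rewrite mxE => /le_trans; apply.
by rewrite -enorm_sqr expr_le1// sqrtr_ge0.
Qed.

Lemma lam_punctured_ball : (lam B < +oo)%E.
Proof.
apply: le_lt_trans (lebesgue_tuple_cube_lty n.+1 1).
apply: le_measure; rewrite ?inE; [|exact: measurable_cube|exact: punctured_ball_cube].
exact: measurable_punctured_ball.
Qed.

Lemma mu0_lty : (mu setT < +oo)%E.
Proof.
by rewrite /mu0 preimage_setT setTI lte_mul_pinfty//; exact: lam_punctured_ball.
Qed.

Lemma integrable_Cinfty f : Cinfty f -> mu.-integrable setT (EFin \o f).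
Proof.
move=> sf; have [C HC] := Cinfty_bounded sf.
apply: measurable_bounded_integrable => //; first exact: mu0_lty.
  exact: measurable_Cinfty.
exists C; split; first exact: num_real.
by move=> y Cy x _ /=; rewrite (le_trans (HC x))// ltW.
Qed.

Definition radialt (t : n.+1.-tuple mR) : S := radial (rowt t).

Lemma measurable_radialt : measurable_fun setT radialt.
Proof. exact: measurable_radial. Qed.

Lemma measurable_Cinfty_radialt f : Cinfty f ->
  measurable_fun setT (f \o radialt : _ -> mR).
Proof.
move=> sf; apply: measurableT_comp; last exact: measurable_radialt.
exact: measurable_Cinfty.
Qed.

Lemma integrable_ball f : Cinfty f -> lam.-integrable B (EFin \o (f \o radialt)).
Proof.
move=> sf; have [C HC] := Cinfty_bounded sf.
apply: measurable_bounded_integrable.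
- exact: measurable_punctured_ball.
- exact: lam_punctured_ball.
- by apply: measurable_funTS; exact: measurable_Cinfty_radialt.
- exists C; split; first exact: num_real.
  by move=> y Cy t _ /=; rewrite (le_trans (HC _))// ltW.
Qed.

Lemma integrable_ball_measure f : Cinfty f ->
  ball_measure.-integrable setT (EFin \o (f \o radialt)).
Proof.
move=> sf; have [C HC] := Cinfty_bounded sf.
apply: measurable_bounded_integrable => //.
- exact: mu0_lty.
- exact: measurable_Cinfty_radialt.
- exists C; split; first exact: num_real.
  by move=> y Cy t _ /=; rewrite (le_trans (HC _))// ltW.
Qed.

Lemma integral_mu0 f : Cinfty f ->
  (\int[mu]_x (f x)%:E = n.+1%:R%:E * \int[lam]_(t in B) (f (radialt t))%:E)%E.
Proof.
move=> sf; transitivity (\int[pushforward ball_measure radialt]_x (f x)%:E)%E.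
  by [].
rewrite (integral_pushforward measurable_radialt) //; last 2 first.
- by apply/measurable_EFinP; exact: measurable_Cinfty.
- exact: integrable_ball_measure.
rewrite preimage_setT; apply: integral_mscale_mrestr.
  by apply/measurable_EFinP; exact: measurable_Cinfty_radialt.
exact: integrable_ball.
Qed.

Lemma Rintegral_mu0 f : Cinfty f ->
  \int[mu]_x f x = n.+1%:R * \int[lam]_(t in B) f (radialt t).
Proof.
move=> sf; rewrite /Rintegral integral_mu0// fineM//.
by apply: integrable_fin_num; [exact: measurable_punctured_ball|exact: integrable_ball].
Qed.

Lemma punctured_ballE (t : n.+1.-tuple mR) : B t <-> 0 < sqnorm (rowt t) <= 1.
Proof.
rewrite /punctured_ball /= -enorm_sqr exprn_even_gt0//= expr_le1 ?sqrtr_ge0//.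
rewrite lt_neqAle sqrtr_ge0 andbT eq_sym; exact.
Qed.

(** Dominated convergence: the plateaus converge to the indicator function of the
    ball, over which [mu0] integrates the radial extension. *)
Lemma integral_mu0_eq0 f : Cinfty f ->
  (forall k, \int[lam]_t (plateau (width R k) (sqnorm (rowt t)) * f (radialt t))%:E = 0)%E ->
  \int[mu]_x f x = 0.
Proof.
move=> sf f0; rewrite Rintegral_mu0// /Rintegral.
suff -> : (\int[lam]_(t in B) (f (radialt t))%:E = 0)%E by rewrite mulr0.
have [C HC] := Cinfty_bounded sf.
pose h (k : nat) (t : n.+1.-tuple mR) : \bar R :=
  (plateau (width R k) (sqnorm (rowt t)) * f (radialt t))%:E.
pose h' (t : n.+1.-tuple mR) : \bar R :=
  ((if 0 < sqnorm (rowt t) <= 1 then 1 else 0) * f (radialt t))%:E.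
have msq : measurable_fun setT ((fun t => sqnorm (rowt t)) : n.+1.-tuple mR -> mR).
  by apply: (@measurable_continuous R n.+1); exact: continuous_sqnorm.
have mh k : measurable_fun setT (h k).
  apply/measurable_EFinP; apply: measurable_funM; last exact: measurable_Cinfty_radialt.
  apply: (@measurable_continuous R n.+1 (fun z => plateau (width R k) (sqnorm z))).
  move=> z; apply: continuous_comp; first exact: continuous_sqnorm.
  exact: (continuous_plateau (width_gt0 R k)).
have hh' t : h k t @[k --> \oo] --> h' t.
  apply: cvg_EFin; first by near=> k.
  by apply: cvgM; [exact: cvg_plateau|exact: cvg_cst].
have mh' : measurable_fun setT h'.
  by apply: emeasurable_fun_cvg mh _ => t _; exact: hh'.
pose dom (t : n.+1.-tuple mR) : \bar R := (C * \1_(cube 2) t)%:E.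
have C0 : 0 <= C by exact: le_trans (HC (radialt [tuple 0 | _ < n.+1])).
have idom : lam.-integrable setT dom.
  apply: (@integrable_restrict_support _ _ _ _ (cube 2) _ C).
  - exact: measurable_cube.
  - exact: lebesgue_tuple_cube_lty.
  - by apply: measurable_funM => //; apply: measurable_indic; exact: measurable_cube.
  - move=> t; rewrite indicE; case: (t \in _); rewrite ?mulr1 ?mulr0 ?normr0//.
    by rewrite ger0_norm.
  - move=> t; rewrite indicE; case: (boolP (t \in _)) => [|_]; first by rewrite inE.
    by rewrite mulr0 eqxx.
have hdom k t : (`|h k t| <= dom t)%E.
  rewrite /h /dom lee_fin normrM.
  have /andP[p0 p1] := plateau_itv (width_gt0 R k) (sqnorm (rowt t)).
  rewrite (ger0_norm p0).
  have [t2|t2] := leP 2 (sqnorm (rowt t)).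
    rewrite plateau_eq0 ?mul0r ?mulr_ge0//; first exact: width_gt0.
    by right; apply: le_trans t2; have := width_le R k; lra.
  rewrite indicE mem_set ?mulr1.
    by rewrite -[leRHS]mul1r ler_pM.
  move=> i /=; rewrite in_itv/= -ler_norml -(@ler_pXn2r _ 2)// ?nnegrE//.
  rewrite real_normK ?num_real//.
  have := sqr_coord_le (rowt t) i; rewrite mxE => /le_trans; apply.
  by rewrite (le_trans (ltW t2))//; lra.
have [_ _] := @dominated_convergence _ _ _ lam setT measurableT h h' dom mh mh'
  (aeW _ (fun t _ => hh' t)) idom (aeW _ (fun t k _ => hdom k t)).
have -> : (fun k => \int[lam]_t h k t)%E = cst 0%E by apply/funext => k; exact: f0.
move=> /cvg_lim; rewrite lim_cst// => -> //.
rewrite [LHS]integral_mkcond; apply: eq_integral => t _; rewrite /h' /patch.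
case: ifPn => [|/negP tB].
  by rewrite inE => /punctured_ballE ->; rewrite mul1r.
by case: ifPn => [/punctured_ballE tB'|]; [exfalso; apply: tB; rewrite inE|rewrite mul0r].
Unshelve. all: by end_near. Qed.

(** Green's identity. The field [psi (|z|^2) G grad F], where [F], [G] are the
    radial extensions of [f], [g] and [psi s] is [s] times a cutoff, has compact
    support, and since [grad F] is orthogonal to [z] its divergence is the cutoff
    times the radial extension of [gradprod f g - g * lap f]. *)
Lemma green f g : Cinfty f -> Cinfty g ->
  \int[mu]_x (gradprod f g x - g x * lap f x) = 0.
Proof.
move=> sf sg.
have sF : smoothU (@nonzero R n.+1) (ray_ext f) by exact/smoothE.
have sG : smoothU (@nonzero R n.+1) (ray_ext g) by exact/smoothE.
have sD : Cinfty (fun x => gradprod f g x - g x * lap f x).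
  by apply: smoothB; [exact: smooth_gradprod|apply: smoothM => //; exact: smooth_lap].
apply: (integral_mu0_eq0 sD) => k.
set del := width R k; have del0 : 0 < del by exact: width_gt0.
have del1 : 1 + del <= 2 by have := width_le R k; rewrite -/del; lra.
pose psi s := s * plateau del s; pose dpsi s := plateau del s + s * dplateau del s.
have Dpsi (s : R) : is_derive s (1 : R) psi (dpsi s).
  rewrite (_ : dpsi s = s *: dplateau del s + plateau del s *: 1).
    exact: (is_deriveM (is_derive_id s 1) (is_derive_plateau del0 s)).
  by rewrite /dpsi /GRing.scale /= mulr1 addrC.
have cdpsi : continuous dpsi.
  move=> s; apply: (@continuousD R R R (plateau del) (fun s => s * dplateau del s)).
    exact: continuous_plateau.
  by apply: (@continuousM R R id (dplateau del)); [exact: cvg_id|exact: continuous_dplateau].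
have psi0 s : s <= del \/ 2 <= s -> psi s = 0.
  move=> h; rewrite /psi plateau_eq0 ?mulr0//.
  by case: h => h; [left|right; exact: le_trans h].
have dpsi0 s : s <= del \/ 2 <= s -> dpsi s = 0.
  move=> h; have h' : s <= del \/ 1 + del <= s.
    by case: h => h; [left|right; exact: le_trans h].
  by rewrite /dpsi plateau_eq0// dplateau_eq0// mulr0 addr0.
pose H i z := ray_ext g z * pd i (ray_ext f) z.
have sH i : smoothU (@nonzero R n.+1) (H i).
  by apply: (smoothUM (@open_nonzero _ _) sG); exact: smoothU_pd.
pose W i := dcutfield psi dpsi (H i) i.
have mW i : measurable_fun setT (W i \o @rowt R n.+1).
  exact: measurable_continuous (continuous_dcutfield del0 Dpsi cdpsi psi0 dpsi0 (sH i)).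
have iW i : lam.-integrable setT (EFin \o (W i \o @rowt R n.+1)).
  apply: integrable_bounded_support => //.
  exact: (@bounded_support_dcutfield _ _ psi dpsi del (H i) i del0 Dpsi cdpsi psi0 dpsi0 (sH i)).
have WE z : \sum_i W i z =
    plateau del (sqnorm z) * ray_ext (fun x => gradprod f g x - g x * lap f x) z.
  have [->|z0] := eqVneq z 0.
    rewrite sqnorm0 plateau_eq0 ?mul0r//; last by left; exact: ltW.
    rewrite big1// => i _; rewrite /W /dcutfield sqnorm0.
    by rewrite psi0 ?dpsi0 ?mul0r ?addr0//; left; exact: ltW.
  have E1 : ray_ext (fun x => gradprod f g x - g x * lap f x) z =
      sqnorm z * (dotgrad (ray_ext f) (ray_ext g) z + ray_ext g z * laplacian (ray_ext f) z).
    rewrite -normpow2//.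
    have hD : homogeneous (-2) (fun z => dotgrad (ray_ext f) (ray_ext g) z +
         ray_ext g z * laplacian (ray_ext f) z).
      have h1 : homogeneous (-2) (dotgrad (ray_ext f) (ray_ext g)).
        rewrite (_ : -2 = -1 + -1); last by ring.
        apply: homogeneous_sum => i.
        by apply: homogeneousM; exact: homogeneous_pd_ray_ext.
      have h2 : homogeneous (-2) (fun z => ray_ext g z * laplacian (ray_ext f) z).
        rewrite (_ : -2 = 0 + (0 - 2)); last by ring.
        apply: homogeneousM; first exact: homogeneous_ray_ext.
        exact: homogeneous_laplacian (homogeneous_ray_ext f).
      by move=> s y s0 y0; rewrite h1// h2// mulrDr.
    rewrite -[X in normpow X]opprK -(ray_ext_homogeneous hD z0).
    congr (ray_ext _ z); apply/funext => x.
    by rewrite gradprodE lapE// ray_ext_val mulrN opprK.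
  rewrite E1 /W /dcutfield /H big_split/= -!mulr_sumr.
  have -> : \sum_i 2 * z ord0 i * (ray_ext g z * pd i (ray_ext f) z) = 0.
    transitivity (2 * ray_ext g z * \sum_i z ord0 i * pd i (ray_ext f) z).
      by rewrite mulr_sumr; apply: eq_bigr => i _; ring.
    by rewrite (euler sF (homogeneous_ray_ext f) z0) mul0r mulr0.
  rewrite mulr0 add0r /psi.
  have -> : \sum_i pd i (fun z => ray_ext g z * pd i (ray_ext f) z) z =
     dotgrad (ray_ext f) (ray_ext g) z + ray_ext g z * laplacian (ray_ext f) z.
    rewrite /dotgrad /laplacian mulr_sumr -big_split/=; apply: eq_bigr => i _.
    rewrite (pdM (nonzero_derivable i sG z0) (nonzero_derivable i (smoothU_pd i sF) z0)).
    by rewrite [pd i (ray_ext g) z * _]mulrC.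
  by ring.
transitivity (\int[lam]_t (\sum_i (W i (rowt t))%:E))%E.
  by apply: eq_integral => t _; rewrite sumEFin WE.
rewrite integral_sum//.
rewrite big1// => i _.
exact: (@integral_dcutfield _ _ psi dpsi del (H i) i del0 Dpsi cdpsi psi0 dpsi0 (sH i)).
Qed.

(** A nonzero value of [f] is approximately kept on a box of positive volume
    inside the ball. *)
Lemma Rintegral_sqr_eq0 f : Cinfty f -> \int[mu]_x (f x * f x) = 0 ->
  forall x, f x = 0.
Proof.
move=> sf I0 x; apply/eqP; apply: contraT => fx0.
have sff : Cinfty (fun x => f x * f x) by exact: smoothM.
pose c := (f x * f x) / 2; have c0 : 0 < c.
  by rewrite divr_gt0// -expr2 exprn_even_gt0.
(* Halfway to the origin, so that a neighbourhood stays in the punctured ball. *)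
pose z0 : E := 2^-1 *: val x.
have z0N : z0 != 0 by rewrite scaler_eq0 negb_or invr_eq0 pnatr_eq0/= val_neq0.
have s0 : sqnorm z0 = 4^-1.
  rewrite -enorm_sqr enormZ enorm_val mulr1 ger0_norm// exprVn.
  by rewrite -natrX.
have fz0 : ray_ext (fun x => f x * f x) z0 = f x * f x.
  by rewrite /ray_ext /= radialZ// radial_val.
have cfz := nonzero_continuous ((smoothE _).1 sff) z0N.
have [r1 r10 H1] := continuous_ball cfz c0.
have [r2 r20 H2] := @continuous_ball _ _ _ _ 8^-1 (continuous_sqnorm (x := z0)) ltac:(by []).
pose r := Num.min r1 r2; have r0 : 0 < r by rewrite lt_min r10.
pose I (i : 'I_n.+1) : set R := `]z0 ord0 i - r, z0 ord0 i + r[%classic.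
have mI i : measurable (I i : set mR) by exact: measurable_itv.
have near_z0 (t : n.+1.-tuple mR) : boxset I t -> `|rowt t - z0| < r.
  move=> It; rewrite /Num.Def.normr /= mx_normrE; apply: bigmax_lt => // -[a i] _ /=.
  rewrite (ord1 a) !mxE; have := It i; rewrite /I /= in_itv/= !mxE => /andP[h1 h2].
  by rewrite ltr_norml; apply/andP; split; lra.
have QB : boxset I `<=` B.
  move=> t /near_z0; rewrite lt_min => /andP[_ /H2].
  rewrite s0 ltr_norml => /andP[h1 h2]; apply/punctured_ballE.
  by apply/andP; split; lra.
have Qc t : boxset I t -> c <= f (radialt t) * f (radialt t).
  move=> /near_z0; rewrite lt_min => /andP[/H1 + _].
  rewrite fz0 ltr_norml => /andP[h1 _].
  rewrite -[f (radialt t) * _]/(ray_ext (fun x => f x * f x) (rowt t)).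
  by rewrite ltW//; move: h1; rewrite /c; lra.
have mQ : measurable (boxset I) by exact: measurable_boxset.
have lQ : (0 < lam (boxset I))%E.
  apply: lebesgue_tuple_boxset_gt0 => // i.
  rewrite /I lebesgue_measure_itv/= lte_fin ifT; last by lra.
  by rewrite -EFinB lte_fin; lra.
have mff := measurable_Cinfty_radialt sff.
have IB : (c%:E * lam (boxset I) <= \int[lam]_(t in B) (f (radialt t) * f (radialt t))%:E)%E.
  rewrite -integral_cst//.
  apply: (@le_trans _ _ (\int[lam]_(t in boxset I) (f (radialt t) * f (radialt t))%:E)%E).
    apply: ge0_le_integral => //.
    - by move=> t _; rewrite lee_fin ltW.
    - by apply/measurable_EFinP; apply: measurable_funTS.
  apply: ge0_subset_integral => //.
  - exact: measurable_punctured_ball.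
  - by apply/measurable_EFinP; apply: measurable_funTS.
  - by move=> t _; rewrite lee_fin -expr2 sqr_ge0.
move: I0; rewrite (Rintegral_mu0 sff) => /eqP; rewrite mulf_eq0 pnatr_eq0/=.
have fI : (\int[lam]_(t in B) (f (radialt t) * f (radialt t))%:E)%E \is a fin_num.
  by apply: integrable_fin_num; [exact: measurable_punctured_ball|exact: (integrable_ball sff)].
rewrite /Rintegral -eqe fineK// => /eqP IB0.
by move: IB; rewrite IB0 leNgt mule_gt0// lte_fin.
Qed.

End sphere_measure.

(** Sealed like [lap]: only linearity, positivity and Green's identity are used
    from here on. *)
HB.lock Definition sphint (R : realType) n (h : sphere R n -> R) : R :=
  \int[@mu0 R n]_x h x.

Section sphint.
Variables (R : realType) (n : nat).
Local Notation S := (sphere R n).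
Implicit Types (f g h : S -> R) (x : S) (b lam : R).

Lemma sphintE h : sphint h = \int[@mu0 R n]_x h x.
Proof. by rewrite unlock. Qed.

Lemma sphintD f g : Cinfty f -> Cinfty g ->
  sphint (fun x => f x + g x) = sphint f + sphint g.
Proof.
move=> sf sg; rewrite !sphintE.
exact: (RintegralD measurableT (integrable_Cinfty sf) (integrable_Cinfty sg)).
Qed.

Lemma sphintZ (c : R) f : Cinfty f -> sphint (fun x => c * f x) = c * sphint f.
Proof.
by move=> sf; rewrite !sphintE; exact: (RintegralZl c measurableT (integrable_Cinfty sf)).
Qed.

Lemma sphintB f g : Cinfty f -> Cinfty g ->
  sphint (fun x => f x - g x) = sphint f - sphint g.
Proof.
move=> sf sg; rewrite !sphintE.
exact: (RintegralB measurableT (integrable_Cinfty sf) (integrable_Cinfty sg)).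
Qed.

Lemma sphint_sqr_eq0 f : Cinfty f -> sphint (fun x => f x * f x) = 0 ->
  forall x, f x = 0.
Proof. by move=> sf; rewrite sphintE; exact: Rintegral_sqr_eq0. Qed.

Lemma sphint_ge0 h : (forall x, 0 <= h x) -> 0 <= sphint h.
Proof. by move=> h0; rewrite sphintE; apply: Rintegral_ge0. Qed.

Lemma sphint_gradprod f g : Cinfty f -> Cinfty g ->
  sphint (fun x => g x * lap f x) = sphint (gradprod f g).
Proof.
move=> sf sg; have s1 := smooth_gradprod sf sg.
have s2 := smoothM sg (smooth_lap sf).
have := sphintB s1 s2; rewrite [LHS]sphintE (green sf sg) => /eqP.
by rewrite eq_sym subr_eq0 => /eqP.
Qed.

Lemma lap_symmetric f g : Cinfty f -> Cinfty g ->
  sphint (fun x => lap f x * g x) = sphint (fun x => f x * lap g x).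
Proof.
move=> sf sg; rewrite (sphint_gradprod sg sf).
transitivity (sphint (fun x => g x * lap f x)).
  by congr sphint; apply/funext => x; rewrite mulrC.
rewrite (sphint_gradprod sf sg); congr sphint.
by apply/funext => x; exact: gradprodC.
Qed.

(** The Rayleigh quotient of [f] is the integral of the squared gradient. *)
Lemma lap_negative lam f : lam < 0 -> eigenfunction lam f -> forall x, f x = 0.
Proof.
move=> lam0 [sf ef]; apply: (sphint_sqr_eq0 sf).
have sff := smoothM sf sf.
have := sphint_gradprod sf sf.
have -> : (fun x => f x * lap f x) = (fun x => lam * (f x * f x)).
  by apply/funext => x; rewrite ef mulrCA.
rewrite (sphintZ _ sff) => E.
have h1 : 0 <= lam * sphint (fun x => f x * f x).
  rewrite E; apply: sphint_ge0 => x; apply: sumr_ge0 => i _.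
  by rewrite -expr2 sqr_ge0.
have h2 : 0 <= sphint (fun x => f x * f x).
  by apply: sphint_ge0 => x; rewrite -expr2 sqr_ge0.
apply/eqP; rewrite eq_le h2 andbT.
by move: h1; rewrite nmulr_rge0.
Qed.

(** An eigenvalue [b (b + n - 1)] with [b] strictly between two consecutive
    integers is lowered, one degree at a time, until [-1 < b < 0], where it is
    negative, hence excluded by the positivity of the Laplacian. *)
Lemma eigenfunction_noninteger (hn : (1 < n)%N) (k : nat) b f :
  k%:R - 1 < b < k%:R -> eigenfunction (b * (b + n%:R - 1)) f ->
  forall x, f x = 0.
Proof.
elim: k b f => [|k IH] b f /andP[bk1 bk2] ef.
  apply: (lap_negative _ ef); rewrite nmulr_rlt0//.
  have : (2 : R) <= n%:R by rewrite ler_nat.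
  by lra.
have b0 : b != 0.
  rewrite gt_eqF// (le_lt_trans _ bk1)// -natr1 addrK; exact: ler0n.
apply: (lower_eq0 b0 ef.1) => i; apply: (IH (b - 1)).
  by move: bk1 bk2; rewrite -natr1; lra.
exact: eigenfunction_lower.
Qed.

(** The spectrum of the Laplacian of the round sphere: write the eigenvalue as
    [b (b + n - 1)] with [b >= 0]. *)
Lemma eigenvalue_sphere lam f : (1 < n)%N -> eigenfunction lam f ->
  (exists j : nat, lam = j%:R * (j%:R + n%:R - 1)) \/ forall x, f x = 0.
Proof.
move=> hn ef; have [lam0|lam0] := ltP lam 0; first by right; exact: lap_negative ef.
pose a : R := n%:R - 1.
have a0 : 0 < a by rewrite subr_gt0 ltr1n.
pose b := (Num.sqrt (a ^+ 2 + 4 * lam) - a) / 2.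
have D0 : 0 <= a ^+ 2 + 4 * lam by rewrite addr_ge0 ?sqr_ge0 ?mulr_ge0.
have lamE : lam = b * (b + n%:R - 1).
  rewrite -addrA -/a /b; move: (sqr_sqrtr D0); set q := Num.sqrt _ => qE.
  have E4 : lam = (q ^+ 2 - a ^+ 2) / 4 by rewrite qE; field.
  by rewrite [LHS]E4; field.
have b0 : 0 <= b.
  rewrite divr_ge0// subr_ge0 -[leLHS]ger0_norm ?(ltW a0)// -sqrtr_sqr.
  by apply: ler_wsqrtr; rewrite lerDl mulr_ge0.
pose k := Num.truncn b.
have /andP[kb bk] := truncn_itv b0.
have [kb0|kNb] := eqVneq k%:R b; first by left; exists k; rewrite kb0.
right; apply: (@eigenfunction_noninteger hn k.+1 b); last by rewrite -lamE.
by rewrite bk andbT -natr1 addrK lt_neqAle kNb.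
Qed.

End sphint.

(** * Polynomials in the Laplacian *)

Section real_factor.
Import complex.
Variable R : rcfType.

Definition quad (a b : R) : {poly R} := ('X - a%:P) ^+ 2 + (b ^+ 2)%:P.

Lemma size_quad a b : size (quad a b) = 3%N.
Proof.
rewrite /quad size_polyDl; first by rewrite size_exp_XsubC.
by rewrite size_exp_XsubC (leq_ltn_trans (size_polyC_leq1 _)).
Qed.

(** A complex root [a + i b] is a real root if [b = 0]; otherwise the remainder
    modulo [quad a b] has degree at most [1] and vanishes at [a + i b], hence is
    zero. *)
Lemma real_poly_factor (p : {poly R}) : (1 < size p)%N ->
  (exists a, root p a) \/ (exists a b, b != 0 /\ quad a b %| p).
Proof.
move=> sp; pose i := real_complex R.
have /closed_rootP [[a b] rz] : size (map_poly i p) != 1%N.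
  by rewrite size_map_poly gtn_eqF.
have [b0|bN0] := eqVneq b 0.
  left; exists a; have : root (map_poly i p) (i a) by rewrite b0 in rz.
  by rewrite fmorph_root.
right; exists a, b; split=> //; rewrite /dvdp.
pose z : R[i] := Complex a b.
set s := quad a b; have sz : (map_poly i s).[z] = 0.
  rewrite /s /quad rmorphD rmorphXn rmorphB/= map_polyX !map_polyC/= !hornerE/=.
  apply/eqP; rewrite eq_complex /= /z /i /=; apply/andP; split; apply/eqP; ring.
have rz0 : (map_poly i (p %% s)).[z] = 0.
  have /rootP := rz; rewrite {1}(divp_eq p s) rmorphD rmorphM/= hornerD hornerM.
  by rewrite -/z sz mulr0 add0r.
have : (size (p %% s)%R <= 2)%N by rewrite -ltnS -(size_quad a b) ltn_modp -size_poly_eq0 size_quad.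
move: rz0; move: (p %% s) => r rz0 sr.
have rE : r = (r`_0)%:P + r`_1 *: 'X.
  apply/polyP => k; rewrite coefD coefC coefZ coefX.
  case: k => [|[|k]]; rewrite ?mulr0 ?mulr1 ?addr0 ?add0r//.
  by rewrite nth_default// (leq_trans sr).
move: rz0; rewrite rE rmorphD/= map_polyC map_polyZ map_polyX/= hornerD hornerC hornerZ hornerX.
move=> /eqP; rewrite eq_complex /= => /andP[/eqP re /eqP im].
have r1 : r`_1 = 0.
  apply/eqP; move: im; rewrite add0r mul0r addr0 => /eqP.
  by rewrite mulf_eq0 (negbTE bN0) orbF.
have r0 : r`_0 = 0 by move: re; rewrite r1 !mul0r subrr addr0.
by rewrite r0 r1 scale0r addr0.
Qed.

End real_factor.

Section polynomial_of_laplacian.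
Variables (R : realType) (n : nat).
Local Notation S := (sphere R n).
Implicit Types (f g : S -> R) (x : S) (p q : {poly R}).

Definition lapn k f : S -> R := iter k (@lap R n) f.
Definition polylap p f x : R := \sum_(k < size p) p`_k * lapn k f x.

Lemma Cinfty_lapn k f : Cinfty f -> Cinfty (lapn k f).
Proof. by move=> sf; elim: k => //= k; exact: smooth_lap. Qed.

Lemma Cinfty_polylap p f : Cinfty f -> Cinfty (polylap p f).
Proof.
move=> sf; apply: (@smooth_sum _ _ _ _ (fun k : 'I_(size p) => fun x => p`_k * lapn k f x)) => k.
by apply: smoothZ; exact: Cinfty_lapn.
Qed.

Lemma polylapE N p f x : (size p <= N)%N ->
  polylap p f x = \sum_(k < N) p`_k * lapn k f x.
Proof.
move=> pN; rewrite /polylap (big_ord_widen N (fun k => p`_k * lapn k f x))//.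
rewrite big_mkcond/=; apply: eq_bigr => k _; case: ltnP => // pk.
by rewrite nth_default// mul0r.
Qed.

Lemma polylapD p q f x : polylap (p + q) f x = polylap p f x + polylap q f x.
Proof.
rewrite !(@polylapE (maxn (size p) (size q))) ?leq_maxl ?leq_maxr ?size_polyD//.
by rewrite -big_split/=; apply: eq_bigr => k _; rewrite coefD mulrDl.
Qed.

Lemma polylapZ c p f x : polylap (c *: p) f x = c * polylap p f x.
Proof.
rewrite !(@polylapE (size p)) ?size_scale_leq// mulr_sumr.
by apply: eq_bigr => k _; rewrite coefZ mulrA.
Qed.

Lemma lapnSr k f : lapn k.+1 f = lapn k (lap f).
Proof. by rewrite /lapn iterSr. Qed.

Lemma polylap_mulX p f x : polylap ('X * p) f x = polylap p (lap f) x.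
Proof.
rewrite (@polylapE (size p).+1); last first.
  by rewrite (leq_trans (size_polyMleq _ _))// size_polyX.
rewrite big_ord_recl /= -['X * p]mulrC coefMX eqxx mul0r add0r.
by apply: eq_bigr => k _; rewrite coefMX /= -lapnSr.
Qed.

Lemma lap_sum N (c : nat -> R) (h : nat -> S -> R) x : (forall k, Cinfty (h k)) ->
  lap (fun y => \sum_(k < N) c k * h k y) x = \sum_(k < N) c k * lap (h k) x.
Proof.
move=> sh; elim: N => [|N IH].
  have L0 := @lapZ _ _ 0 (cst 0) x (smooth_cst n 0).
  rewrite mul0r in L0; rewrite [RHS]big_ord0 -[RHS]L0.
  by congr (lap _ x); apply/funext => y; rewrite big_ord0 mul0r.
rewrite big_ord_recr/= -IH -lapZ; last exact: sh.
rewrite -lapD.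
- by congr (lap _ x); apply/funext => y; rewrite big_ord_recr.
- apply: (@smooth_sum _ _ _ _ (fun k : 'I_N => fun y => c k * h k y)) => k.
  exact: smoothZ.
- exact: smoothZ.
Qed.

Lemma lap_polylap p f x : Cinfty f -> lap (polylap p f) x = polylap p (lap f) x.
Proof.
move=> sf; rewrite (lap_sum (size p) (fun k => p`_k)); last first.
  by move=> k; exact: Cinfty_lapn.
by apply: eq_bigr => k _; rewrite -lapnSr.
Qed.

Lemma lapnD k f g x : Cinfty f -> Cinfty g ->
  lapn k (fun y => f y + g y) x = lapn k f x + lapn k g x.
Proof.
move=> sf sg; elim: k x => [//|k IH] x /=.
rewrite -lapD; [|exact: Cinfty_lapn|exact: Cinfty_lapn].
by congr (lap _ x); apply/funext => y; exact: IH.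
Qed.

Lemma lapnZ k c f x : Cinfty f -> lapn k (fun y => c * f y) x = c * lapn k f x.
Proof.
move=> sf; elim: k x => [//|k IH] x /=.
rewrite -lapZ; last exact: Cinfty_lapn.
by congr (lap _ x); apply/funext => y; exact: IH.
Qed.

Lemma polylap_addr p f g x : Cinfty f -> Cinfty g ->
  polylap p (fun y => f y + g y) x = polylap p f x + polylap p g x.
Proof.
by move=> sf sg; rewrite -big_split/=; apply: eq_bigr => k _; rewrite lapnD// mulrDr.
Qed.

Lemma polylap_scaler p c f x : Cinfty f ->
  polylap p (fun y => c * f y) x = c * polylap p f x.
Proof.
by move=> sf; rewrite mulr_sumr; apply: eq_bigr => k _; rewrite lapnZ// mulrCA.
Qed.

Definition sublap (a : R) f x : R := lap f x - a * f x.

Lemma Cinfty_sublap a f : Cinfty f -> Cinfty (sublap a f).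
Proof. by move=> sf; apply: smoothB; [exact: smooth_lap|exact: smoothZ]. Qed.

Lemma sublapE a f : sublap a f = fun x => lap f x + - a * f x.
Proof. by apply/funext => x; rewrite mulNr. Qed.

Lemma polylap_mulXsubC a p f x : Cinfty f ->
  polylap (('X - a%:P) * p) f x = polylap p (sublap a f) x.
Proof.
move=> sf; rewrite sublapE mulrDl polylapD polylap_mulX -polyCN mul_polyC polylapZ.
rewrite polylap_addr; [|exact: smooth_lap|exact: smoothZ].
by rewrite polylap_scaler.
Qed.

Lemma polylap_mulquad a b p f x : Cinfty f ->
  polylap (quad a b * p) f x =
  polylap p (fun y => sublap a (sublap a f) y + b ^+ 2 * f y) x.
Proof.
move=> sf; have s1 := Cinfty_sublap a sf; have s2 := Cinfty_sublap a s1.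
rewrite /quad mulrDl polylapD expr2 -mulrA !polylap_mulXsubC// mul_polyC polylapZ.
by rewrite polylap_addr//; [rewrite polylap_scaler|exact: smoothZ].
Qed.

Lemma polylap_const c f x : polylap c%:P f x = c * f x.
Proof. by rewrite (@polylapE 1) ?size_polyC_leq1// big_ord1 coefC. Qed.

Lemma polylap_eigen lam p f x : eigenfunction lam f -> polylap p f x = p.[lam] * f x.
Proof.
move=> [sf ef]; rewrite horner_coef mulr_suml; apply: eq_bigr => k _.
rewrite -mulrA; congr (_ * _).
elim: (k : nat) x => [|j IH] x /=; first by rewrite expr0 mul1r.
rewrite (_ : lapn j f = fun y => lam ^+ j * f y); last exact/funext.
by rewrite lapZ// ef exprSr mulrA.
Qed.

Lemma sublap_comm a b f x : Cinfty f -> sublap a (sublap b f) x = sublap b (sublap a f) x.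
Proof.
move=> sf; have slf := smooth_lap sf.
have E c : lap (sublap c f) x = lap (lap f) x - c * lap f x.
  rewrite sublapE lapD//; last exact: smoothZ.
  by rewrite lapZ// mulNr.
by rewrite {1}/sublap E [RHS]/sublap E /sublap; ring.
Qed.

Lemma sublap_symmetric a f g : Cinfty f -> Cinfty g ->
  sphint (fun x => sublap a f x * g x) = sphint (fun x => f x * sublap a g x).
Proof.
move=> sf sg.
have sfg : Cinfty (fun x => a * (f x * g x)) by apply: smoothZ; exact: smoothM.
have s1 := smoothM (smooth_lap sf) sg; have s2 := smoothM sf (smooth_lap sg).
have -> : (fun x => sublap a f x * g x) = fun x => lap f x * g x - a * (f x * g x).
  by apply/funext => x; rewrite /sublap; ring.
have -> : (fun x => f x * sublap a g x) = fun x => f x * lap g x - a * (f x * g x).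
  by apply/funext => x; rewrite /sublap; ring.
by rewrite (sphintB s1 sfg) (sphintB s2 sfg) lap_symmetric.
Qed.

(** [sublap a] is symmetric, so the squared norm of [sublap a f] is the inner
    product of [f] with [sublap a (sublap a f)]. *)
Lemma sublap_sqr_eq0 a f : Cinfty f -> (forall x, sublap a (sublap a f) x = 0) ->
  forall x, sublap a f x = 0.
Proof.
move=> sf f0; have s1 := Cinfty_sublap a sf; apply: (sphint_sqr_eq0 s1).
rewrite (sublap_symmetric a sf s1).
have -> : (fun x => f x * sublap a (sublap a f) x) = fun x => 0 * (f x * f x).
  by apply/funext => x; rewrite f0 mulr0 mul0r.
by rewrite (sphintZ 0 (smoothM sf sf)) mul0r.
Qed.

(** The inner product of the equation with [f] is a sum of two squared norms. *)
Lemma sublap_quad_eq0 a b f : b != 0 -> Cinfty f ->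
  (forall x, sublap a (sublap a f) x + b ^+ 2 * f x = 0) -> forall x, f x = 0.
Proof.
move=> b0 sf f0; have s1 := Cinfty_sublap a sf; apply: (sphint_sqr_eq0 sf).
have sff := smoothM sf sf.
have N1 : 0 <= sphint (fun x => sublap a f x * sublap a f x).
  by apply: sphint_ge0 => x; rewrite -expr2 sqr_ge0.
have N2 : 0 <= sphint (fun x => f x * f x).
  by apply: sphint_ge0 => x; rewrite -expr2 sqr_ge0.
move: N1; rewrite (sublap_symmetric a sf s1).
have -> : (fun x => f x * sublap a (sublap a f) x) = fun x => - b ^+ 2 * (f x * f x).
  apply/funext => x; have /eqP := f0 x; rewrite addr_eq0 => /eqP ->; ring.
rewrite (sphintZ _ sff) mulNr oppr_ge0 => N1.
by apply/eqP; rewrite eq_le N2 andbT -(pmulr_rle0 _ (_ : 0 < b ^+ 2))// exprn_even_gt0.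
Qed.

(** In substance, the symmetric operator [lap] is diagonalizable on the
    finite-dimensional space generated by [f] and its iterated Laplacians, with
    eigenvalues among the roots of [p]. Concretely, the real irreducible factors of
    [p] are removed one by one, as they give injective operators, except for
    ['X - n%:R], whose repetitions are absorbed by [sublap_sqr_eq0]. *)
Lemma polylap_kernel p f : (1 < n)%N -> p != 0 ->
  (forall j : nat, root p (j%:R * (j%:R + n%:R - 1)) -> j = 1%N) ->
  Cinfty f -> (forall x, polylap p f x = 0) -> forall x, sublap n%:R f x = 0.
Proof.
move=> hn; elim: {p}(size p) {-2}p (leqnn (size p)) f => [p|N IH p] sp f p0 rp sf pf.
  by move: p0; rewrite -size_poly_leq0 sp.
have sg := Cinfty_sublap n%:R sf.
have [sp1|sp1] := leqP (size p) 1.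
  have pE := size1_polyC sp1.
  have c0 : p`_0 != 0 by apply: contraNneq p0 => c0; rewrite pE c0.
  have f0 x : f x = 0.
    by apply: (mulfI c0); rewrite mulr0 -(polylap_const p`_0 f x) -pE pf.
  move=> x; rewrite /sublap f0 mulr0 subr0.
  have -> : f = fun x => 0 * f x by apply/funext => y; rewrite mul0r.
  by rewrite lapZ// mul0r.
have [[a]|[a [b [b0]]]] := real_poly_factor sp1.
  move=> ra; have /factor_theorem [q pE] := ra.
  have q0 : q != 0 by apply: contraNneq p0 => q0; rewrite pE q0 mul0r.
  have sq : (size q <= N)%N.
    move: sp; rewrite pE size_mul ?polyXsubC_eq0// size_XsubC addnS/= addn1.
    by rewrite ltnS.
  have rq (j : nat) : root q (j%:R * (j%:R + n%:R - 1)) -> j = 1%N.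
    by move=> rj; apply: rp; rewrite pE rootM rj.
  have s1 := Cinfty_sublap a sf.
  have H x : sublap n%:R (sublap a f) x = 0.
    by apply: (IH q) => // y; rewrite -polylap_mulXsubC// mulrC -pE.
  have eg : eigenfunction a (sublap n%:R f).
    split=> // x; apply/eqP; rewrite -subr_eq0; apply/eqP.
    by rewrite -[RHS](H x) -sublap_comm.
  have [[j aE]|//] := eigenvalue_sphere hn eg.
  have aN : a = n%:R.
    by move: ra; rewrite aE => /rp ->; rewrite mul1r addrAC subrr add0r.
  by apply: sublap_sqr_eq0 => // x; rewrite -{1}aN sublap_comm// H.
move=> /dvdpP [q pE].
have q0 : q != 0 by apply: contraNneq p0 => q0; rewrite pE q0 mul0r.
have sq : (size q <= N)%N.
  have Q0 : quad a b != 0 by rewrite -size_poly_eq0 size_quad.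
  move: sp; rewrite pE size_mul// size_quad addn3/= => h.
  exact: (leq_trans (leqnSn _) h).
have rq (j : nat) : root q (j%:R * (j%:R + n%:R - 1)) -> j = 1%N.
  by move=> rj; apply: rp; rewrite pE rootM rj.
have s1 := Cinfty_sublap a sf; have s2 := Cinfty_sublap a s1.
have sb := smoothZ (b ^+ 2) sf.
have H x : sublap n%:R (fun y => sublap a (sublap a f) y + b ^+ 2 * f y) x = 0.
  apply: (IH q) => //; first exact: smoothD.
  by move=> y; rewrite -polylap_mulquad// mulrC -pE.
apply: (sublap_quad_eq0 b0 sg (a := a)) => x; rewrite -[RHS](H x).
have -> : sublap n%:R (fun y => sublap a (sublap a f) y + b ^+ 2 * f y) x =
    sublap n%:R (sublap a (sublap a f)) x + b ^+ 2 * sublap n%:R f x.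
  by rewrite /sublap -/(sublap a f) lapD// lapZ//; ring.
congr (_ + _); rewrite -sublap_comm//.
by congr (sublap a _ x); apply/funext => y; exact: sublap_comm.
Qed.

End polynomial_of_laplacian.

(** * The linearization of the Q-curvature increment *)

Section paneitz.
Variables (R : realType) (n : nat).
Local Notation S := (sphere R n).
Implicit Types (f g v w : S -> R) (x : S) (t : R).
Local Notation h := (n%:R / 2 : R).

(** [P0_factor k] is [lap] plus this constant, and [gjms m] is the polynomial in
    [lap] that equals [P0 m]. *)
Definition pshift (k : nat) : R := (h - k%:R) * (h + k%:R - 1).
Definition gjmsr (r : seq nat) : {poly R} := \prod_(k <- r) ('X + (pshift k)%:P).
Definition gjms (m : nat) : {poly R} := gjmsr (index_iota 1 m.+1).
Definition P0r (r : seq nat) : (S -> R) -> S -> R := \big[comp/id]_(k <- r) @P0_factor R n k.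

Lemma P0E m : @P0 R n m = P0r (index_iota 1 m.+1). Proof. by []. Qed.

Lemma P0_factorE k f x : P0_factor k f x = lap f x + pshift k * f x.
Proof. by rewrite unlock. Qed.

Lemma P0r_cons k r f x : P0r (k :: r) f x = lap (P0r r f) x + pshift k * P0r r f x.
Proof. by rewrite -P0_factorE /P0r big_cons. Qed.

Lemma P0rE r f : Cinfty f -> P0r r f = polylap (gjmsr r) f.
Proof.
move=> sf; elim: r => [|k r IH]; apply/funext => x.
  by rewrite /P0r /gjmsr !big_nil polylap_const mul1r.
rewrite P0r_cons IH /gjmsr big_cons mulrDl polylapD polylap_mulX mul_polyC polylapZ.
by rewrite -lap_polylap.
Qed.

(** Polynomials in [t] whose coefficients are functions on the sphere, in Horner
    form. *)
Fixpoint hfam (s : seq (S -> R)) t x : R :=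
  if s is a :: s' then a x + t * hfam s' t x else 0.

Fixpoint allC (s : seq (S -> R)) : Prop :=
  if s is a :: s' then Cinfty a /\ allC s' else True.

Fixpoint hadd (s1 s2 : seq (S -> R)) : seq (S -> R) :=
  match s1, s2 with
  | a :: s1', b :: s2' => (fun x => a x + b x) :: hadd s1' s2'
  | [::], _ => s2
  | _, [::] => s1
  end.

Lemma Cinfty_hfam s t : allC s -> Cinfty (hfam s t).
Proof.
elim: s => [_|a s IH [sa /IH ss]] /=; first exact: smooth_cst.
by apply: smoothD => //; exact: smoothZ.
Qed.

Lemma hfam_add s1 s2 t x : hfam (hadd s1 s2) t x = hfam s1 t x + hfam s2 t x.
Proof.
elim: s1 s2 => [|a s1 IH] [|b s2] /=; rewrite ?add0r ?addr0//.
by rewrite IH; ring.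
Qed.

Lemma allC_add s1 s2 : allC s1 -> allC s2 -> allC (hadd s1 s2).
Proof.
elim: s1 s2 => [|a s1 IH] [|b s2] //= [sa ss1] [sb ss2].
by split; [exact: smoothD|exact: IH].
Qed.

Lemma allC_map (L : (S -> R) -> S -> R) s : (forall a, Cinfty a -> Cinfty (L a)) ->
  allC s -> allC (map L s).
Proof. by move=> sL; elim: s => //= a s IH [sa ss]; split; [exact: sL|exact: IH]. Qed.

Lemma hfam_linear (L : (S -> R) -> S -> R) s t x :
  (forall a c b, Cinfty a -> Cinfty b -> L (fun y => a y + c * b y) x = L a x + c * L b x) ->
  L (cst 0) x = 0 -> allC s -> L (hfam s t) x = hfam (map L s) t x.
Proof.
move=> linL L0; elim: s => [//|a s IH] /= [sa ss].
by rewrite linL// ?IH//; exact: Cinfty_hfam.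
Qed.

Lemma lap0_linear x a c b : Cinfty a -> Cinfty b ->
  lap (fun y => a y + c * b y) x = lap a x + c * lap b x :> R.
Proof. by move=> sa sb; rewrite lapD ?lapZ//; exact: smoothZ. Qed.

Lemma lap_cst0 x : lap (cst 0) x = 0 :> R.
Proof.
have L0 := @lapZ _ _ 0 (cst 0) x (smooth_cst n 0).
rewrite mul0r in L0; rewrite -[RHS]L0.
by congr (lap _ x); apply/funext => y; rewrite mul0r.
Qed.

Lemma gradprodDr w a b x : Cinfty a -> Cinfty b ->
  gradprod w (fun y => a y + b y) x = gradprod w a x + gradprod w b x.
Proof.
move=> /smoothE sa /smoothE sb; rewrite !gradprodE -big_split; apply: eq_bigr => i _ /=.
rewrite -mulrDr; congr (_ * _); have x0 := val_neq0 x.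
exact: (pdD (nonzero_derivable i sa x0) (nonzero_derivable i sb x0)).
Qed.

Lemma gradprod_linear w x a c b : Cinfty a -> Cinfty b ->
  gradprod w (fun y => a y + c * b y) x = gradprod w a x + c * gradprod w b x.
Proof.
move=> sa sb; rewrite gradprodDr//; last exact: smoothZ.
by congr (_ + _); rewrite gradprodC gradprodZ// gradprodC.
Qed.

Lemma gradprod_cst0 w x : gradprod w (cst 0) x = 0.
Proof.
have L0 := @gradprodZ _ _ 0 (cst 0) w x (smooth_cst n 0).
rewrite mul0r in L0; rewrite gradprodC -[RHS]L0.
by congr (gradprod _ w x); apply/funext => y; rewrite mul0r.
Qed.

(** One factor of the Paneitz operator maps [exp (t w)] times such a polynomial to
    [exp (t w)] times the polynomial with these coefficients: the Laplacian of the
    exponential has terms in [t] and [t ^ 2], hence the shifts by [cst 0]. *)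
Definition hstep w (k : nat) (s : seq (S -> R)) : seq (S -> R) :=
  hadd (map (fun a x => lap a x + pshift k * a x) s)
    (hadd (cst 0 :: map (fun a x => a x * lap w x - 2 * gradprod w a x) s)
          (cst 0 :: cst 0 :: map (fun a x => - gradprod w w x * a x) s)).

Lemma allC_hstep w k s : Cinfty w -> allC s -> allC (hstep w k s).
Proof.
move=> sw ss; have s0 := smooth_cst n (0 : R).
apply: allC_add; last apply: allC_add; rewrite /=; repeat split => //.
all: apply: allC_map ss => a sa.
- by apply: smoothD; [exact: smooth_lap|exact: smoothZ].
- apply: smoothB; first by apply: smoothM => //; exact: smooth_lap.
  by apply: smoothZ; exact: smooth_gradprod.
- have -> : (fun x => - gradprod w w x * a x) = (fun x => -1 * (gradprod w w x * a x)).
    by apply/funext => x; ring.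
  by apply: smoothZ; apply: smoothM => //; exact: smooth_gradprod.
Qed.

Lemma hfam_hstep w k s t x : Cinfty w -> allC s ->
  P0_factor k (fun y => expR (t * w y) * hfam s t y) x =
  expR (t * w x) * hfam (hstep w k s) t x.
Proof.
move=> sw ss; have sH := Cinfty_hfam t ss; have stw := smoothZ t sw.
have se := smooth_expR stw.
rewrite P0_factorE lapM// lap_expR// lapZ// gradprod_expR// !gradprodZ//.
rewrite [gradprod w (fun y => t * w y) x]gradprodC gradprodZ//.
rewrite /hstep !hfam_add /= !add0r.
have -> : hfam [seq (fun x => lap a x + pshift k * a x) | a <- s] t x =
    lap (hfam s t) x + pshift k * hfam s t x.
  rewrite -(@hfam_linear (fun a x => lap a x + pshift k * a x))//.
    by move=> a c b sa sb; rewrite lap0_linear//; ring.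
  by rewrite lap_cst0 mulr0 addr0.
have -> : hfam [seq (fun x => a x * lap w x - 2 * gradprod w a x) | a <- s] t x =
    hfam s t x * lap w x - 2 * gradprod w (hfam s t) x.
  rewrite -(@hfam_linear (fun a x => a x * lap w x - 2 * gradprod w a x))//.
    by move=> a c b sa sb; rewrite gradprod_linear//; ring.
  by rewrite gradprod_cst0 mulr0 mul0r subr0.
have -> : hfam [seq (fun x => - gradprod w w x * a x) | a <- s] t x =
    - gradprod w w x * hfam s t x.
  rewrite -(@hfam_linear (fun a x => - gradprod w w x * a x))//.
    by move=> a c b sa sb; ring.
  by rewrite mulr0.
by ring.
Qed.

(** The derivative at [t = 0] of [exp (t w)] times the polynomial [s]. *)
Definition hderiv w (s : seq (S -> R)) x : R :=
  w x * nth (cst 0) s 0 x + nth (cst 0) s 1 x.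

(** The derivative at [t = 0] commutes with the factors of the Paneitz operator:
    the terms in [hstep] of first order in [t] are those of [lap (w * a)]. *)
Lemma hderiv_hstep w k a b s x : Cinfty w -> allC [:: a, b & s] ->
  hderiv w (hstep w k [:: a, b & s]) x = P0_factor k (hderiv w [:: a, b & s]) x.
Proof.
move=> sw [sa [sb ss]]; rewrite P0_factorE.
rewrite /hderiv /= lapD//; last exact: smoothM.
by rewrite lapM//; ring.
Qed.

Lemma hstep_size w k a b s : exists a' b' s', hstep w k [:: a, b & s] = [:: a', b' & s'].
Proof. by rewrite /hstep /=; do 3!eexists. Qed.

(** Two coefficients suffice to know the derivative at [t = 0]; the others are
    left unspecified. *)
Lemma hfam_P0r w r : Cinfty w -> exists a b s, [/\ allC [:: a, b & s],
  (forall t x, P0r r (fun y => expR (t * w y)) x = expR (t * w x) * hfam [:: a, b & s] t x) &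
  hderiv w [:: a, b & s] = P0r r w].
Proof.
move=> sw; elim: r => [|k r [a [b [s [ss Hs Ds]]]]].
  exists (cst 1), (cst 0), [::]; split.
  - by split; [exact: smooth_cst|split=> //; exact: smooth_cst].
  - by move=> t x; rewrite /P0r big_nil /=; ring.
  - by rewrite /P0r big_nil; apply/funext => x; rewrite /hderiv /=; ring.
have [a' [b' [s' E]]] := hstep_size w k a b s.
exists a', b', s'; rewrite -E; split.
- exact: allC_hstep.
- move=> t x; rewrite -hfam_hstep// P0_factorE P0r_cons.
  by rewrite (_ : P0r r _ = fun y => expR (t * w y) * hfam [:: a, b & s] t y)//; exact/funext.
- by apply/funext => x; rewrite hderiv_hstep// P0_factorE P0r_cons Ds.
Qed.

Lemma is_derive_mul (F G : R -> R) (s a b : R) : is_derive s (1 : R) F a ->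
  is_derive s (1 : R) G b -> is_derive s (1 : R) (fun t => F t * G t) (a * G s + F s * b).
Proof.
move=> dF dG; rewrite addrC [a * _]mulrC.
exact: (is_deriveM dF dG).
Qed.

Lemma is_derive_scaleid (c s : R) : is_derive s (1 : R) (fun t => t * c) c.
Proof.
have := is_derive_mul (is_derive_id s 1) (is_derive_cst c s 1).
by rewrite mul1r mulr0 addr0.
Qed.

Lemma is_derive_exp0 (c : R) : is_derive (0 : R) (1 : R) (fun t => expR (t * c)) c.
Proof.
have := @is_derive1_comp _ (@expR R) (fun t => t * c) 0 _ _ (is_derive_expR _) (is_derive_scaleid c 0).
by rewrite mul0r expR0 mul1r.
Qed.

Lemma derivable_hfam s x (t : R) : derivable (fun t => hfam s t x) t 1.
Proof.
elim: s => [|a s IH] /=; first exact: derivable_cst.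
have D := is_derive_mul (is_derive_id t 1) (derivableP IH).
by case: (is_deriveD (is_derive_cst (a x) t 1) D).
Qed.

Lemma is_derive_hfam a b s x :
  is_derive (0 : R) (1 : R) (fun t => hfam [:: a, b & s] t x) (b x).
Proof.
have D := is_derive_mul (is_derive_id (0 : R) 1) (derivableP (@derivable_hfam (b :: s) x 0)).
have := is_deriveD (is_derive_cst (a x) (0 : R) 1) D.
by rewrite /= !mul0r mul1r !addr0 add0r.
Qed.

(** The linearized operator is this polynomial evaluated at [lap]. *)
Definition qpoly (m : nat) : {poly R} :=
  if n == (2 * m)%N then gjms m - ((2 * m)`!%:R)%:P
  else (h - m%:R) *: gjms m - ((h + m%:R) * (gjms m).[0])%:P.

Lemma eigenfunction_1 : eigenfunction 0 (cst 1 : S -> R).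
Proof.
split=> [|x]; first exact: smooth_cst.
have sc := smooth_cst n (1 : R).
have L1 := @lapM _ _ (cst 1) (cst 1) x sc sc.
have G1 : gradprod (cst 1) (cst 1) x = 0 :> R.
  have := @gradprod_expR _ _ (cst 0) (cst 1) x (smooth_cst n 0) sc.
  have -> : (fun y : S => expR (cst 0 y : R)) = cst 1 by apply/funext => y; rewrite expR0.
  by move=> ->; rewrite gradprodC gradprod_cst0 mulr0.
have E1 : (fun y : S => (cst 1 y : R) * cst 1 y) = cst 1 by apply/funext => y; rewrite mulr1.
by move: L1; rewrite E1 G1 mulr0 subr0 !mul1r mul0r; lra.
Qed.

Lemma polylap1 p x : polylap p (cst 1) x = p.[0].
Proof. by rewrite (polylap_eigen p x eigenfunction_1) mulr1. Qed.

Lemma half_sub_neq0 m : n != (2 * m)%N -> h - m%:R != 0.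
Proof.
apply: contraNneq => nm; rewrite -(eqr_nat R) natrM -[m%:R]add0r -nm; apply/eqP.
by field.
Qed.

(** For [n <> 2m] the inner exponential contributes [(h - m) P0 v] and the outer one
    [- (h + m) P0(1) v], where [P0(1)] is the constant [(gjms m).[0]]. *)
Lemma is_derive_Qincr m v x : (0 < m)%N -> Cinfty v ->
  is_derive (0 : R) (1 : R) (fun t => Qincr m (fun y => t * v y) x) (polylap (qpoly m) v x).
Proof.
move=> m0 sv; rewrite /Qincr /Qcurv /qpoly; case: eqP => [nm|/eqP nm].
  have -> : (fun t => expR (- (2 * m)%:R * (t * v x)) * (((2 * m).-1)`!%:R +
      P0 m (fun y => t * v y) x) - Q0 m x) =
    (fun t => expR (t * (- (2 * m)%:R * v x)) * (((2 * m).-1)`!%:R +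
      t * polylap (gjms m) v x) - Q0 m x).
    apply/funext => t; rewrite P0E P0rE; last exact: smoothZ.
    by rewrite polylap_scaler// mulrCA.
  have D1 := is_derive_exp0 (- (2 * m)%:R * v x).
  have D2 := is_deriveD (is_derive_cst (((2 * m).-1)`!%:R : R) (0 : R) 1)
    (is_derive_scaleid (polylap (gjms m) v x) 0).
  have D3 := is_deriveB (is_derive_mul D1 D2) (is_derive_cst (Q0 m x) (0 : R) 1).
  apply: is_derive_eq D3 _.
  rewrite /= subr0 add0r mul0r expR0 mul1r fctE mul0r addr0.
  rewrite polylapD -polyCN polylap_const [RHS]addrC; congr (_ + _).
  have m2 : (0 < 2 * m)%N by rewrite muln_gt0.
  rewrite -[in X in _ = - X * _](prednK m2) factS prednK// natrM; ring.
have hm := half_sub_neq0 nm.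
pose w y := (h - m%:R) * v y.
have sw : Cinfty w by exact: smoothZ.
have [a [b [s [ss Hs Ds]]]] := hfam_P0r (index_iota 1 m.+1) sw.
have aE y : a y = (gjms m).[0].
  have := Hs 0 y; rewrite mul0r expR0 mul1r /= mul0r addr0 => <-.
  rewrite -(polylap1 (gjms m) y) -P0rE; last exact: smooth_cst.
  by congr (P0r _ _ y); apply/funext => u; rewrite mul0r expR0.
have -> : (fun t => (h - m%:R) * ((h - m%:R)^-1 * Pconf m (fun y => t * v y) (cst 1) x - Q0 m x)) =
    (fun t => expR (t * (- (h + m%:R) * v x)) * (expR (t * w x) * hfam [:: a, b & s] t x)
      - (h - m%:R) * Q0 m x).
  apply/funext => t; rewrite mulrBr [X in X - _]mulrA divff// mul1r; congr (_ - _).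
  rewrite /Pconf mulrCA; congr (_ * _); rewrite -Hs P0E.
  by congr (P0r _ _ x); apply/funext => y; rewrite mulr1 mulrCA.
have D1 := is_derive_exp0 (- (h + m%:R) * v x).
have D2 := is_derive_mul (is_derive_exp0 (w x)) (is_derive_hfam a b s x).
have D3 := is_deriveB (is_derive_mul D1 D2) (is_derive_cst ((h - m%:R) * Q0 m x) (0 : R) 1).
apply: is_derive_eq D3 _.
rewrite /= subr0 !mul0r expR0 !mul1r addr0 aE.
have := congr1 (fun F : S -> R => F x) Ds; rewrite P0rE// /w polylap_scaler// -/(gjms m).
rewrite /hderiv /= aE => E1.
rewrite polylapD polylapZ -polyCN polylap_const -E1 /w.
by ring.
Qed.

Lemma sphint_sum N (c : nat -> R) (F : nat -> S -> R) : (forall k, Cinfty (F k)) ->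
  sphint (fun x => \sum_(k < N) c k * F k x) = \sum_(k < N) c k * sphint (F k).
Proof.
move=> sF; elim: N => [|N IH].
  have Z := sphintZ 0 (smooth_cst n (0 : R)).
  rewrite mul0r in Z; rewrite big_ord0 -[RHS]Z.
  by congr sphint; apply/funext => x; rewrite big_ord0 mul0r.
rewrite big_ord_recr/= -IH -sphintZ// -sphintD.
- by congr sphint; apply/funext => x; rewrite big_ord_recr.
- apply: (@smooth_sum _ _ _ _ (fun k : 'I_N => fun y => c k * F k y)) => k.
  exact: smoothZ.
- exact: smoothZ.
Qed.

Lemma polylap_symmetric p f g : Cinfty f -> Cinfty g ->
  sphint (fun x => polylap p f x * g x) = sphint (fun x => f x * polylap p g x).
Proof.
move=> sf sg.
have lapn_sym k : sphint (fun x => lapn k f x * g x) = sphint (fun x => f x * lapn k g x).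
  elim: k g sg => [//|k IH] g sg.
  by rewrite /= (lap_symmetric (Cinfty_lapn k sf) sg) (IH _ (smooth_lap sg)) -lapnSr.
have E1 : (fun x => polylap p f x * g x) = fun x => \sum_(k < size p) p`_k * (lapn k f x * g x).
  by apply/funext => x; rewrite mulr_suml; apply: eq_bigr => k _; rewrite mulrA.
have E2 : (fun x => f x * polylap p g x) = fun x => \sum_(k < size p) p`_k * (f x * lapn k g x).
  by apply/funext => x; rewrite mulr_sumr; apply: eq_bigr => k _; rewrite mulrCA.
rewrite E1 E2.
rewrite (@sphint_sum _ (fun k => p`_k) (fun k x => lapn k f x * g x)) => [|k]; last first.
  by apply: smoothM => //; exact: Cinfty_lapn.
rewrite (@sphint_sum _ (fun k => p`_k) (fun k x => f x * lapn k g x)) => [|k]; last first.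
  by apply: smoothM => //; exact: Cinfty_lapn.
by apply: eq_bigr => k _; rewrite lapn_sym.
Qed.

End paneitz.

Section eigenvalues.
Variable R : realType.
Implicit Types (u : R) (m n j k : nat).

(** The value of [gjms m] at [j (j + n - 1)] when [u = n / 2 + j]; it equals
    [Gamma (u + m) / Gamma (u - m)], whence [gval_shift]. *)
Definition gval m u : R := \prod_(1 <= k < m.+1) ((u - k%:R) * (u + k%:R - 1)).

Lemma gval_shift m u : gval m (u + 1) * (u - m%:R) = gval m u * (u + m%:R).
Proof.
elim: m => [|m IH]; first by rewrite /gval !big_geq// subr0 addr0.
have gS v : gval m.+1 v = gval m v * ((v - m.+1%:R) * (v + m.+1%:R - 1)).
  by rewrite /gval big_nat_recr.
rewrite !gS -[m.+1%:R]natr1.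
transitivity (gval m (u + 1) * (u - m%:R) * ((u + 1 + m%:R) * (u - (m%:R + 1)))); first by ring.
by rewrite IH; ring.
Qed.

Lemma gval_neq0 m u : (forall k, (0 < k <= m)%N -> u - k%:R != 0) -> 1 <= u ->
  gval m u != 0.
Proof.
move=> uk u1; rewrite /gval prodf_seq_neq0; apply/allP => k.
rewrite mem_index_iota ltnS mulf_eq0 negb_or /= => kr; rewrite uk//= gt_eqF//.
have : (1 : R) <= k%:R by rewrite ler1n; case/andP: kr.
by lra.
Qed.

(** The quotient of the two values is [(u + m) / (u - m)], which exceeds [1] in
    absolute value. *)
Lemma gval_increasing m u : (0 < m)%N -> 0 < u -> u - m%:R != 0 -> gval m u != 0 ->
  `|gval m u| < `|gval m (u + 1)|.
Proof.
move=> m0 u0 um g0; have m0' : (0 : R) < m%:R by rewrite ltr0n.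
have a0 : 0 < `|u - m%:R| by rewrite normr_gt0.
rewrite -(ltr_pM2r a0) -[X in _ < X]normrM gval_shift normrM.
rewrite ltr_pM2l ?normr_gt0// [X in _ < X]ger0_norm; last by lra.
by rewrite ltr_norml; apply/andP; split; lra.
Qed.

Lemma gval_one_factorial m : gval m (m%:R + 1) = (2 * m)`!%:R.
Proof.
have P r : (r <= m)%N ->
    \prod_(1 <= k < r.+1) ((m%:R + 1 - k%:R) * (m%:R + 1 + k%:R - 1)) * (m - r)`!%:R
    = (m + r)`!%:R :> R.
  elim: r => [|r IH] rm; first by rewrite big_geq// mul1r subn0 addn0.
  rewrite big_nat_recr//= addnS factS natrM -IH 1?ltnW//.
  have -> : (m - r = (m - r.+1).+1)%N by lia.
  rewrite factS natrM -!natr1 natrB//= -!natr1 natrD; ring.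
by have := P m (leqnn m); rewrite subnn mulr1 addnn -mul2n.
Qed.

Lemma gval_m_eq0 m : (0 < m)%N -> gval m m%:R = 0.
Proof. by case: m => // m _; rewrite /gval big_nat_recr//= subrr mul0r mulr0. Qed.

Lemma gval_lt m u j : (0 < m)%N -> 1 <= u ->
  (forall i k : nat, (0 < k <= m)%N -> u + i%:R - k%:R != 0) ->
  `|gval m u| < `|gval m (u + j.+1%:R)|.
Proof.
move=> m0 u1 uk.
have step i : `|gval m (u + i%:R)| < `|gval m (u + i.+1%:R)|.
  have i0 : (0 : R) <= i%:R by rewrite ler0n.
  rewrite -natr1 addrA; apply: gval_increasing => //; first by lra.
    by apply: uk; rewrite m0 /=.
  by apply: gval_neq0; [exact: uk|lra].
elim: j => [|j IH]; first by have := step 0%N; rewrite addr0.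
exact: (lt_trans IH (step j.+1)).
Qed.

Lemma horner_gjms n m j :
  (gjms R n m).[j%:R * (j%:R + n%:R - 1)] = gval m (n%:R / 2 + j%:R).
Proof.
rewrite /gjms /gjmsr /gval horner_prod; apply: eq_bigr => k _.
by rewrite hornerD hornerX hornerC /pshift; field.
Qed.

(** In both cases the value of [qpoly] is a nonzero multiple of
    [gval m (n / 2 + j) - gval m (n / 2 + 1)], and [|gval m (n / 2 + j)|] increases
    strictly with [j]: admissibility keeps [n / 2 + j] away from [1, ..., m], except
    for [j = 0] when [n = 2m], where [gval] vanishes. *)
Lemma qpoly_root n m j : admissible m n ->
  root (qpoly R n m) (j%:R * (j%:R + n%:R - 1)) = (j == 1%N).
Proof.
move=> [m0 n1 nm]; rewrite rootE /qpoly; case: ifPn => [/eqP E|nE].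
  have hm : n%:R / 2 = m%:R :> R by rewrite E natrM; field.
  rewrite hornerD hornerN hornerC horner_gjms hm subr_eq0 -gval_one_factorial.
  have inc := @gval_lt m (m%:R + 1) _ m0.
  case: j => [|[|j]]; rewrite ?eqxx//.
    rewrite addr0 gval_m_eq0// gval_one_factorial eq_sym.
    by apply/eqP/eqP; rewrite pnatr_eq0 -lt0n fact_gt0.
  have <- : m%:R + 1 + j.+1%:R = m%:R + j.+2%:R :> R by rewrite -[j.+2%:R]natr1; ring.
  apply/eqP => H; have := inc j; rewrite H ltxx => F; apply: notF; apply: F; first by rewrite lerDr ler0n.
  move=> i k /andP[k0 km]; rewrite gt_eqF//.
  have : (k%:R : R) <= m%:R by rewrite ler_nat.
  have : (0 : R) <= i%:R by rewrite ler0n.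
  by lra.
have hm := half_sub_neq0 R nE.
have ne i k : (0 < k <= m)%N -> n%:R / 2 + i%:R - k%:R != 0 :> R.
  move=> /andP[k0 km]; apply/eqP => H.
  have : ((n + 2 * i)%:R : R) = (2 * k)%:R by rewrite natrD !natrM; lra.
  move=> /eqP; rewrite eqr_nat => /eqP; move: nE; lia.
have h1 : (1 : R) <= n%:R / 2.
  by have : (2%:R : R) <= n%:R; [rewrite ler_nat|lra].
have g0 := horner_gjms n m 0; rewrite mul0r addr0 in g0.
have sh := gval_shift m (n%:R / 2 : R).
rewrite hornerD hornerN hornerC hornerZ horner_gjms g0.
have -> : (n%:R / 2 - m%:R) * gval m (n%:R / 2 + j%:R) - (n%:R / 2 + m%:R) * gval m (n%:R / 2) =
   (n%:R / 2 - m%:R) * (gval m (n%:R / 2 + j%:R) - gval m (n%:R / 2 + 1)) :> R.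
  by rewrite mulrBr [_ * gval m (_ + 1)]mulrC sh; ring.
rewrite mulf_eq0 (negbTE hm) /= subr_eq0.
case: j => [|[|j]]; rewrite ?eqxx//.
  rewrite addr0; apply/eqP => H.
  by have := gval_lt 0 m0 h1 ne; rewrite H ltxx.
have <- : n%:R / 2 + 1 + j.+1%:R = n%:R / 2 + j.+2%:R :> R by rewrite -[j.+2%:R]natr1; ring.
apply/eqP => H.
have := @gval_lt m (n%:R / 2 + 1) j m0; rewrite H ltxx => F; apply: notF; apply: F; first by lra.
by move=> i k /(ne i.+1); rewrite -natr1; apply: contraNneq => <-; apply/eqP; ring.
Qed.

End eigenvalues.

Theorem lemma1 (R : realType) (m n : nat) (hmn : admissible m n) :
  (forall v : sphere R n -> R, smooth v ->
     (forall x : sphere R n,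
        derivable (fun t : R => Qincr m (fun y => t * v y) x) 0 1) /\
     smooth (linQ m v)) /\
  formally_self_adjoint (@linQ R n m) /\
  Ker (@linQ R n m) = @Lambda1 R n.
Proof.
have [m0 n1 _] := hmn.
have linE (v : sphere R n -> R) : Cinfty v -> linQ m v = polylap (qpoly R n m) v.
  move=> sv; apply/funext => x; rewrite /linQ derive1E.
  by have [_ ->] := is_derive_Qincr x m0 sv.
have rootE1 : (qpoly R n m).[n%:R] = 0.
  have /rootP := qpoly_root R 1 hmn.
  by rewrite mul1r addrAC subrr add0r; apply.
have lapE1 (v : sphere R n -> R) : smooth v -> (forall x, lap0 v x = n%:R * v x) <->
    eigenfunction n%:R v.
  by move=> /CinftyE sv; split=> [ev|[_ ev] x]; [split=> // x|rewrite -ev]; rewrite unlock.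
split=> [v /CinftyE sv|]; [split=> [x|]|split=> [v w /CinftyE sv /CinftyE sw|]].
- by case: (is_derive_Qincr x m0 sv).
- by apply/CinftyE; rewrite linE//; exact: Cinfty_polylap.
- by rewrite !linE// -!sphintE polylap_symmetric.
apply/seteqP; split=> v [sv kv]; split=> //.
- apply/lapE1 => //; split=> [|x]; first exact/CinftyE.
  apply/eqP; rewrite -subr_eq0; apply/eqP; move: x.
  have sv' : Cinfty v by exact/CinftyE.
  apply: (@polylap_kernel _ _ (qpoly R n m)) => //.
  + apply: contraPneq (qpoly_root R 0 hmn) => ->.
    by rewrite root0.
  + by move=> j; rewrite qpoly_root// => /eqP.
  + by move=> x; rewrite -linE.
- move=> x; have sv' : Cinfty v by exact/CinftyE.
  by rewrite linE// (polylap_eigen _ _ (iffLR (lapE1 v sv) kv)) rootE1 mul0r.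
Qed.
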